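(* Let $z_1,\dots,z_n$ be distinct complex numbers. Then $$\tilde\Phi^{[n]}(u,v)=\tilde{\mathcal{P}}(u,v;z_1,\dots,z_n;H^{[n]}_1,\dots,H^{[n]}_n).$$
   Context: $\mathfrak{S}_n$ is the symmetric group; $\sigma_{a,b}$ is the transposition of $a$ and $b$. For distinct $r_1,\dots,r_m\in\{1,\dots,n\}$, $\pi^{[n]}_{r_1,\dots,r_m}:\mathbb{C}[\mathfrak{S}_m]\to\mathbb{C}[\mathfrak{S}_n]$ is the embedding induced by $i\mapsto r_i$. $A^{[m]}=\frac1{m!}\sum_{\sigma\in\mathfrak{S}_m}\mathrm{sign}(\sigma)\,\sigma$. For $i=1,\dots,n$ put $$\Phi^{[n]}_i(u)=\sum_{1\le r_1<\dots<r_i\le n} i!\;\pi^{[n]}_{r_1,\dots,r_i}(A^{[i]})\prod_{1\le b\le n,\ b\notin\{r_1,\dots,r_i\}}(u-z_b).$$ For a partition $\lambda$ of $n$ ($\lambda\vdash n$), $M_\lambda$ is the corresponding irreducible $\mathfrak{S}_n$-module ($M_{(n)}$ trivial), $\chi_\lambda\in\mathbb{C}[\mathfrak{S}_n]$ is the central idempotent acting as the identity on $M_\lambda$ and as zero on $M_\mu$, $\mu\ne\lambda$; $\Pi_\lambda(v)=\prod_{i=1}^n\prod_{j=1}^{\lambda_i}(v+i-j)$, and $\Pi(v)=\sum_{\lambda\vdash n}\chi_\lambda\Pi_\lambda(v)$. Set $$\tilde\Phi^{[n]}(u,v)=\Pi(v+1)\Bigl(\prod_{a=1}^n(u-z_a)+\sum_{i=1}^n(-u)^i\,\Phi^{[n]}_i(u)\prod_{j=1}^i\frac1{v+j}\Bigr)$$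 (this is in fact a polynomial in $u,v$ with coefficients in $\mathbb{C}[\mathfrak{S}_n]$). For distinct $z_1,\dots,z_n$, the (pairwise commuting) KZ elements are $H^{[n]}_a=\sum_{b\ne a}\dfrac{\sigma_{a,b}}{z_a-z_b}$, $a=1,\dots,n$. Let $Z=\mathrm{diag}(z_1,\dots,z_n)$ and let $Q$ be the $n\times n$ matrix with $Q_{aa}=h_a$ and $Q_{ab}=\frac1{z_a-z_b}$ for $a\ne b$, where $h_1,\dots,h_n$ are commuting variables. Put $$\tilde{\mathcal{P}}(u,v;z_1,\dots,z_n;h_1,\dots,h_n)=\det\bigl((u-Z)(v-ZQ)-Z\bigr),$$ where scalars stand for multiples of the identity matrix. *)

(* Defs.v *)
From HB Require Import structures.
From mathcomp Require Import all_boot all_order all_algebra all_fingroup.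
From mathcomp Require Import complex reals.
From mathcomp Require Import mpoly.

Set Implicit Arguments.
Unset Strict Implicit.
Unset Printing Implicit Defensive.
Import GRing.Theory.
Local Open Scope ring_scope.

(* The group algebra K[G] of a finite group: functions G -> K under
   convolution.  The product on basis elements is the group law of gT; for
   gT = 'S_n, MathComp's s * t applies s first.  With the opposite convention
   one gets the opposite algebra, isomorphic to this one through s |-> s^-1;
   every element of K['S_n] built below is fixed by that anti-isomorphism. *)

Definition galg (K : comNzRingType) (gT : finGroupType) := {ffun gT -> K}.

Section GroupAlgebra.
Context (K : comNzRingType) (gT : finGroupType).
Local Notation A := (galg K gT).
Implicit Types (x y t : A) (g h : gT).

HB.instance Definition _ := GRing.Zmodule.on A.

Definition galg_scale (c : K) x : A := [ffun g => c * x g].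

Lemma galg_scaleA c d x : galg_scale c (galg_scale d x) = galg_scale (c * d) x.
Proof. by apply/ffunP=> g; rewrite !ffunE mulrA. Qed.

Lemma galg_scale1 : left_id 1 galg_scale.
Proof. by move=> x; apply/ffunP=> g; rewrite ffunE mul1r. Qed.

Lemma galg_scaleDr : right_distributive galg_scale +%R.
Proof. by move=> c x y; apply/ffunP=> g; rewrite !ffunE mulrDr. Qed.

Lemma galg_scaleDl x : {morph galg_scale^~ x : c d / c + d}.
Proof. by move=> c d; apply/ffunP=> g; rewrite !ffunE mulrDl. Qed.

HB.instance Definition _ := GRing.Zmodule_isLmodule.Build K A
  galg_scaleA galg_scale1 galg_scaleDr galg_scaleDl.

Definition gbase g : A := [ffun h => (h == g)%:R].

Definition galg_mul x y : A := [ffun g => \sum_h x h * y (h^-1 * g)%g].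

Lemma galg_mulA : associative galg_mul.
Proof.
move=> x y t; apply/ffunP=> g; rewrite !ffunE.
under eq_bigr => h _ do rewrite ffunE mulr_sumr.
under [RHS]eq_bigr => h _ do rewrite ffunE mulr_suml.
rewrite [RHS]exchange_big /=; apply: eq_bigr => h _.
rewrite [RHS](reindex_inj (mulgI h)) /=; apply: eq_bigr => k _.
by rewrite mulKg invMg !mulgA mulrA.
Qed.

Lemma galg_mul1x : left_id (gbase 1) galg_mul.
Proof.
move=> x; apply/ffunP=> g; rewrite ffunE (bigD1 1%g) //= ffunE eqxx mul1r.
by rewrite invg1 mul1g big1 ?addr0 // => h /negPf h1; rewrite ffunE h1 mul0r.
Qed.

Lemma galg_mulx1 : right_id (gbase 1) galg_mul.
Proof.
move=> x; apply/ffunP=> g; rewrite ffunE (bigD1 g) //= ffunE mulVg eqxx mulr1.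
rewrite big1 ?addr0 // => h hg; rewrite ffunE -eq_mulVg1 (negPf hg).
by rewrite mulr0.
Qed.

Lemma galg_mulDl : left_distributive galg_mul +%R.
Proof.
move=> x y t; apply/ffunP=> g; rewrite !ffunE -big_split /=.
by apply: eq_bigr => h _; rewrite ffunE mulrDl.
Qed.

Lemma galg_mulDr : right_distributive galg_mul +%R.
Proof.
move=> x y t; apply/ffunP=> g; rewrite !ffunE -big_split /=.
by apply: eq_bigr => h _; rewrite ffunE mulrDr.
Qed.

Lemma galg_1neq0 : gbase 1 != 0.
Proof. by apply/eqP=> /ffunP/(_ 1%g)/eqP; rewrite !ffunE eqxx oner_eq0. Qed.

HB.instance Definition _ := GRing.Zmodule_isNzRing.Build A
  galg_mulA galg_mul1x galg_mulx1 galg_mulDl galg_mulDr galg_1neq0.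

Lemma galg_scaleAl (c : K) x y : c *: (x * y) = c *: x * y.
Proof.
apply/ffunP=> g; rewrite !ffunE /= mulr_sumr; apply: eq_bigr => h _.
by rewrite ffunE mulrA.
Qed.

HB.instance Definition _ := GRing.Lmodule_isLalgebra.Build K A galg_scaleAl.

Lemma galg_scaleAr (c : K) x y : c *: (x * y) = x * (c *: y).
Proof.
apply/ffunP=> g; rewrite !ffunE /= mulr_sumr; apply: eq_bigr => h _.
by rewrite ffunE mulrCA.
Qed.

HB.instance Definition _ := GRing.Lalgebra_isAlgebra.Build K A galg_scaleAr.

Lemma gbaseM g h : gbase (g * h) = gbase g * gbase h.
Proof.
apply/ffunP=> k; rewrite !ffunE (bigD1 g) //= big1 ?addr0.
  by rewrite !ffunE eqxx mul1r -[in RHS](inj_eq (mulgI g)) mulKVg.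
by move=> i /negPf ig; rewrite ffunE ig mul0r.
Qed.

End GroupAlgebra.

Arguments gbase K {gT} g.

(* Extension of scalars along f. *)
Definition map_galg (K L : comNzRingType) (f : K -> L) (gT : finGroupType)
  (x : galg K gT) : galg L gT := [ffun g => f (x g)].

(* Integer partitions of n, padded with zeros to length n. *)

Definition is_intpart (n : nat) (la : n.-tuple 'I_n.+1) : bool :=
  sorted geq (map val la) && (sumn (map val la) == n).

Definition intpart (n : nat) := {la : n.-tuple 'I_n.+1 | is_intpart la}.

Definition parts (n : nat) (la : intpart n) : seq nat := map val (val la).

(* The irreducible module M_la is the left ideal generated by the Young
   symmetrizer of the standard tableau of shape la filled with 0, ..., n-1 row
   by row.  [reshape_index]/[reshape_offset] give the row and the column of
   the box that contains k. *)

Definition tab_row (n : nat) (la : intpart n) (k : 'I_n) : nat :=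
  reshape_index (parts la) k.

Definition tab_col (n : nat) (la : intpart n) (k : 'I_n) : nat :=
  reshape_offset (parts la) k.

Definition young_symmetrizer (K : comNzRingType) (n : nat) (la : intpart n) :
    galg K 'S_n :=
  (\sum_(s : 'S_n | [forall k, tab_row la (s k) == tab_row la k]) gbase K s)
  * (\sum_(s : 'S_n | [forall k, tab_col la (s k) == tab_col la k])
        (-1) ^+ s *: gbase K s).

Definition in_irr (K : comNzRingType) (n : nat) (la : intpart n)
    (m : galg K 'S_n) : Prop :=
  exists x : galg K 'S_n, m = x * young_symmetrizer K la.

Definition is_central_idempotent (K : comNzRingType) (n : nat)
    (la : intpart n) (e : galg K 'S_n) : Prop :=
  [/\ forall x, e * x = x * e,
      e * e = e,
      forall m, in_irr la m -> e * m = m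
    & forall mu, mu != la -> forall m, in_irr mu m -> e * m = 0].

(* The embedding of symmetric groups induced by an injective r: it sends s to
   the permutation r k |-> r (s k) fixing all points outside the range of r.
   [insubd] makes it total; see [sym_embE]. *)

Definition sym_emb_fun (m n : nat) (r : 'I_m -> 'I_n) (s : 'S_m) (a : 'I_n) :
    'I_n :=
  if [pick k | r k == a] is Some k then r (s k) else a.

Definition sym_emb (m n : nat) (r : 'I_m -> 'I_n) (s : 'S_m) : 'S_n :=
  insubd (1%g : 'S_n) (finfun (sym_emb_fun r s)).

Lemma sym_embE (m n : nat) (r : 'I_m -> 'I_n) (s : 'S_m) : injective r ->
  sym_emb r s =1 sym_emb_fun r s.
Proof.
move=> rI.
have fI : injectiveb (finfun (sym_emb_fun r s)).
  apply/injectiveP=> a b; rewrite !ffunE /sym_emb_fun.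
  case: pickP => [k /eqP <-|ka]; case: pickP => [l /eqP <-|lb] //.
  - by move/rI/perm_inj->.
  - by move=> e; have := lb (s k); rewrite e eqxx.
  - by move=> e; have := ka (s l); rewrite e eqxx.
by move=> a; rewrite -pvalE /= val_insubd fI ffunE.
Qed.

Definition galg_emb (K : comNzRingType) (m n : nat) (r : 'I_m -> 'I_n)
    (x : galg K 'S_m) : galg K 'S_n :=
  \sum_(s : 'S_m) x s *: gbase K (sym_emb r s).

Definition antisym (K : fieldType) (m : nat) : galg K 'S_m :=
  (m`!%:R)^-1 *: \sum_(s : 'S_m) (-1) ^+ s *: gbase K s.

Definition strictly_increasing (m n : nat) (r : {ffun 'I_m -> 'I_n}) : bool :=
  [forall j : 'I_m, forall k : 'I_m, (j < k)%N ==> (r j < r k)%N].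

(* Throughout, K is a field containing the values of u, v, z. *)

Definition Phi (K : fieldType) (n : nat) (z : 'I_n -> K) (i : nat) (u : K) :
    galg K 'S_n :=
  \sum_(r : {ffun 'I_i -> 'I_n} | strictly_increasing r)
    (\prod_(b < n | b \notin codom r) (u - z b))
      *: (i`!%:R *: galg_emb r (antisym K i)).

Definition Pi_part (K : fieldType) (n : nat) (la : intpart n) (v : K) : K :=
  \prod_(1 <= i < n.+1) \prod_(1 <= j < (nth 0%N (parts la) i.-1).+1)
    (v + i%:R - j%:R).

Definition Pi (K : fieldType) (n : nat) (chi : intpart n -> galg K 'S_n)
    (v : K) : galg K 'S_n :=
  \sum_(la : intpart n) Pi_part la v *: chi la.

Definition Phi_tilde (K : fieldType) (n : nat) (chi : intpart n -> galg K 'S_n)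
    (z : 'I_n -> K) (u v : K) : galg K 'S_n :=
  Pi chi (v + 1)
  * ((\prod_(a < n) (u - z a))%:A
     + \sum_(1 <= i < n.+1)
         ((- u) ^+ i * \prod_(1 <= j < i.+1) (v + j%:R)^-1) *: Phi z i u).

Definition KZ (K : fieldType) (n : nat) (z : 'I_n -> K) (a : 'I_n) :
    galg K 'S_n :=
  \sum_(b < n | b != a) (z a - z b)^-1 *: gbase K (tperm a b).

(* Polynomials in the commuting variables h_a = 'X_a. *)

Definition Qmx (K : fieldType) (n : nat) (z : 'I_n -> K) :
    'M[{mpoly K[n]}]_n :=
  \matrix_(a < n, b < n) if a == b then 'X_a else ((z a - z b)^-1)%:MP.

Definition P_tilde (K : fieldType) (n : nat) (z : 'I_n -> K) (u v : K) :
    {mpoly K[n]} :=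
  let Z : 'M[{mpoly K[n]}]_n := diag_mx (\row_(a < n) (z a)%:MP) in
  \det ((u%:MP%:M - Z) *m (v%:MP%:M - Z *m Qmx z) - Z).

(* Substitution h_a := H a; the library's [mmap] takes the product of the H a
   in the order of the indices, which is immaterial when they commute. *)
Definition subst_galg (K : fieldType) (n : nat) (H : 'I_n -> galg K 'S_n)
    (p : {mpoly K[n]}) : galg K 'S_n :=
  mmap (fun c : K => c%:A) H p.

(* The field F(u, v): fractions of polynomials in u with coefficients in
   F[v]. *)

Definition ratfrac2 (F : fieldType) : fieldType := {fraction {poly {poly F}}}.

Definition rf_const (F : fieldType) (c : F) : ratfrac2 F := tofrac c%:P%:P.

Definition rf_u (F : fieldType) : ratfrac2 F := tofrac ('X : {poly {poly F}}).

Definition rf_v (F : fieldType) : ratfrac2 F := tofrac ('X : {poly F})%:P.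

(* Main.v *)
Require Import Defs.
From mathcomp Require Import all_boot all_order all_algebra all_fingroup.
From mathcomp Require Import complex reals.
From mathcomp Require Import mpoly.
From mathcomp Require Import bigenough ring.
Import GRing.Theory BigEnough.
Local Open Scope ring_scope.
Set Implicit Arguments.
Unset Strict Implicit.
Unset Printing Implicit Defensive.

(** Both sides are equal to the weighted cycle sum
      W = \sum_s sgn(s) * \prod_(c cycle of s) (v * al_c + be_c) * s,
    where al_c and be_c are the products over the cycle c of al_i = u - z_i and
    of be_i = - z_i.

    Left-hand side.  Let C(w) = \sum_s sgn(s) * w ^ (number of cycles of s) * s.
    Building permutations one point at a time factors C(w) as a product of
    w - J_k, where the J_k are the Jucys-Murphy elements ([cycsum_rec]).  A
    Young symmetrizer of a tableau filled row by row is an eigenvector of each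
    J_k, with the content of the box of k as eigenvalue ([jm_young]), so C(w)
    acts on it by Pi_la(w).  The elements chi_la are linearly independent
    because they act differently on the symmetrizers, and there are as many of
    them as cycle types; hence they form a basis of the centre, which contains
    C(w), and Pi(w) = C(w) ([Pi_cycsumT]).  The same factorization shows that
    C(v + 1) times the antisymmetrizer of an i-element set R is
    (v + 1)...(v + i) times the sum of sgn(s) * (v + 1) ^ m(s) * s, where m(s)
    counts the cycles of s that avoid R ([cycsum_mul_wcycsum]).  The denominators
    disappear, and the sum over R, carried out point by point, gives W
    ([wcycsum_split]).

    Right-hand side.  The determinant is treated for a finite set U of points
    of which some, those outside N, have already been moved to 0, by induction
    on the number of points in N ([gaudin_det_identity]).  One point z_a with a
    in N is replaced by an indeterminate x, and the two sides are compared as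
    rational functions of x.  At the points z_b the entries of the rows a and b
    of the matrix, and the elements H_a and H_b, have poles; these cancel in
    the determinant ([gaudin_no_pole]), since at first order the residues are
    exchanged by the transposition of a and b.  At x = 0 the row a becomes
    diagonal, and the induction hypothesis for N without a gives equality.  At
    infinity both sides are O(x); the leading coefficients are equal by the
    induction hypothesis for N and U without a.  The difference of the two
    sides, divided by x, is therefore a rational function without poles which
    vanishes at infinity, hence zero ([rat_liouville]). *)

(** * Signed cycle sums and Jucys-Murphy elements *)

Section CycleSum.
Context (K : comNzRingType) (n : nat).
Local Notation A := (galg K 'S_n).
Implicit Types (a b : 'I_n) (U V D E : {set 'I_n}) (s t : 'S_n) (w : K).

Definition transp a b : A := gbase K (tperm a b).

Definition jm a U : A := \sum_(j in U) transp a j.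

(** The exponent is the number of cycles of [s] inside [U]: each point outside
    [U] is fixed, so that [s] has [#|~: U|] further orbits. *)
Definition cycsum U w : A :=
  \sum_(s : 'S_n | perm_on U s)
    ((-1) ^+ s * w ^+ (#|porbits s| - #|~: U|)) *: gbase K s.

Lemma porbit_fixed s a : s a = a -> porbit s a = [set a].
Proof.
move=> sa; apply/setP=> b; rewrite inE; apply/porbitP/eqP=> [[i ->]|->].
  by rewrite permX; elim: i => //= i ->.
by exists 0; rewrite expg0 perm1.
Qed.

Lemma leq_card_fixed_porbits U s : perm_on U s -> (#|~: U| <= #|porbits s|)%N.
Proof.
move=> sU.
have fixU a : a \in ~: U -> porbit s a = [set a].
  by rewrite inE => aU; apply/porbit_fixed/(out_perm sU).
have fI : {in ~: U &, injective (porbit s)}.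
  by move=> a b aU bU; rewrite !fixU // => /set1_inj.
rewrite -(card_in_imset fI).
by apply/subset_leq_card/subsetP=> _ /imsetP[a _ ->]; apply: imset_f.
Qed.

Lemma perm_on_setU1P a U s :
  a \notin U -> perm_on (a |: U) s && (s^-1%g a == a) = perm_on U s.
Proof.
move=> aU; apply/andP/idP => [[sU /eqP sa]|sU].
  have {}sa : s a = a by rewrite -{1}sa permKV.
  apply/subsetP=> b sb; have := subsetP sU b sb.
  by rewrite in_setU1 => /orP[/eqP ba|//]; rewrite inE ba sa eqxx in sb.
split; last by rewrite -{1}(out_perm sU aU) permK.
by apply: subset_trans sU (subsetUr _ _).
Qed.

(** A permutation of [a |: U] is obtained from one of [U] either by adding the
    fixed point [a], which creates a cycle, or by inserting [a] right after some
    [j] of [U], which multiplies by a transposition and creates no cycle. *)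
Lemma cycsum_rec a U w : a \notin U ->
  cycsum (a |: U) w = (w%:A - jm a U) * cycsum U w.
Proof.
move=> aU; rewrite mulrBl -scalerAl mul1r.
rewrite /cycsum (partition_big (fun s => s^-1%g a) (fun j => j \in a |: U)); last first.
  move=> s sU; apply/negPn/negP=> saU.
  have := out_perm sU saU; rewrite permKV => e.
  by move: saU; rewrite -e setU11.
have cU : #|~: U| = #|~: (a |: U)|.+1.
  rewrite setCU setIC -setDE (cardsD1 a (~: U)) inE aU add1n; congr _.+1.
rewrite (bigD1 a) ?setU11 //=; congr (_ + _).
  rewrite scaler_sumr; apply: eq_big => [s|s sU].
    exact: perm_on_setU1P.
  rewrite scalerA mulrCA -exprS -subSn ?cU ?subSS //.
  by rewrite -cU; apply: leq_card_fixed_porbits; rewrite -(perm_on_setU1P _ aU) sU.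
rewrite /jm mulr_suml -sumrN.
apply: eq_big => [j|j /andP[jU ja]].
  by rewrite in_setU1 andbC; case: eqVneq => //= ->; rewrite (negPf aU).
have {}jU : j \in U by move: jU; rewrite in_setU1 (negPf ja).
rewrite mulr_sumr -sumrN (reindex_inj (mulgI (tperm a j))) /=.
have onE s : perm_on (a |: U) (tperm a j * s)%g && ((tperm a j * s)^-1%g a == j)
    = perm_on U s.
  rewrite -(perm_on_setU1P s aU); congr (_ && _).
    have tU : perm_on (a |: U) (tperm a j).
      apply/subsetP=> b; rewrite inE !in_setU1.
      by case: tpermP => [->|->|_ _ /eqP//]; rewrite ?eqxx ?jU ?orbT.
    apply/idP/idP=> sU; last exact: perm_onM.
    by rewrite -(mulKg (tperm a j) s) tpermV; apply: perm_onM.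
  by rewrite invMg permM tpermV -{2}(tpermL a j) (inj_eq perm_inj).
apply: eq_big => [s|s]; rewrite onE // => sU.
rewrite odd_permM odd_tperm eq_sym ja signr_addb expr1 mulN1r mulNr.
rewrite scaleNr -scalerAr -gbaseM; congr (- (_ *: _)); congr (_ * w ^+ _).
have := porbits_mul_tperm s a j.
have -> : a \notin porbit s j.
  by rewrite porbit_sym porbit_fixed ?(out_perm sU) // inE.
rewrite /= eq_sym ja addn2 addn1 => -[<-].
by rewrite cU subSS.
Qed.

Lemma transp_sym a b : transp a b = transp b a.
Proof. by rewrite /transp tpermC. Qed.

Lemma transp_sqr a b : transp a b * transp a b = 1.
Proof. by rewrite /transp -gbaseM tperm2. Qed.

Lemma transp_gbase a b s :
  transp a b * gbase K s = gbase K s * transp (s a) (s b).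
Proof. by rewrite -!gbaseM -tpermJ conjgE !mulgA mulgV mul1g. Qed.

Lemma transp_comm a b c d : a != c -> a != d -> b != c -> b != d ->
  transp a b * transp c d = transp c d * transp a b.
Proof.
by move=> ac ad bc bd; rewrite transp_gbase !tpermD // 1?eq_sym.
Qed.

Lemma transp_braidl a b c : a != b -> b != c ->
  transp a b * transp a c = transp a c * transp b c.
Proof.
move=> ab; rewrite eq_sym => cb.
by rewrite [LHS]transp_gbase tpermL tpermD // (transp_sym b c).
Qed.

Lemma transp_braidr a b c : a != b -> a != c ->
  transp a c * transp b c = transp b c * transp a b.
Proof.
rewrite eq_sym => ba; rewrite eq_sym => ca.
by rewrite [LHS]transp_gbase tpermR tpermD.
Qed.

Lemma comm_gbase_jm s a U : s a = a -> s @: U = U ->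
  GRing.comm (jm a U) (gbase K s).
Proof.
move=> sa sU; rewrite /GRing.comm /jm mulr_suml mulr_sumr -[in RHS]sU.
rewrite big_imset /=; last by move=> b c _ _; apply: perm_inj.
by apply: eq_bigr => b _; rewrite transp_gbase sa.
Qed.

Lemma comm_cycsum V w (x : A) :
  (forall s, perm_on V s -> GRing.comm x (gbase K s)) ->
  GRing.comm x (cycsum V w).
Proof.
move=> xV; rewrite /GRing.comm /cycsum mulr_suml mulr_sumr.
by apply: eq_bigr => s sV; rewrite -scalerAr xV // scalerAl.
Qed.

Lemma comm_jm_cycsum_disjoint V w a U : a \notin V -> [disjoint V & U] ->
  GRing.comm (jm a U) (cycsum V w).
Proof.
move=> aV /pred0P VU; apply: comm_cycsum => s sV.
apply: comm_gbase_jm; first exact: out_perm sV aV.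
rewrite -[RHS]imset_id; apply: eq_in_imset => b bU; apply: (out_perm sV).
by have := VU b; rewrite /= bU andbT => ->.
Qed.

(** Conjugation by a permutation of [V] fixes [a] and permutes [U]. *)
Lemma comm_jm_cycsum_sub V w a U : a \notin V -> V \subset U ->
  GRing.comm (jm a U) (cycsum V w).
Proof.
move=> aV VU; apply: comm_cycsum => s sV.
apply: comm_gbase_jm; first exact: out_perm sV aV.
apply/setP=> b; rewrite -{1}(permKV s b) mem_imset; last exact: perm_inj.
have sU : perm_on U s^-1%g by apply/perm_onV/(subset_trans sV).
exact: perm_closed.
Qed.

Lemma cycsum_recr a U w : a \notin U ->
  cycsum (a |: U) w = cycsum U w * (w%:A - jm a U).
Proof.
move=> aU; rewrite cycsum_rec // mulrBl mulrBr; congr (_ - _).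
  by rewrite -scalerAl -scalerAr mul1r mulr1.
exact: comm_jm_cycsum_sub.
Qed.

Lemma cycsum0 w : cycsum set0 w = 1.
Proof.
rewrite /cycsum (big_pred1 1%g) => [|s]; last first.
  apply/idP/eqP=> [sU|->]; last exact: perm_on1.
  by apply/permP=> a; rewrite perm1 (out_perm sU) ?inE.
have porb1 : porbits (1 : 'S_n)%g = [set [set a] | a in 'I_n].
  by apply: eq_imset => a; rewrite porbit_fixed // perm1.
rewrite odd_perm1 porb1 card_imset; last exact: set1_inj.
by rewrite setC0 cardsT subnn mulr1 scale1r.
Qed.

Lemma jmU a D E : [disjoint D & E] -> jm a (D :|: E) = jm a D + jm a E.
Proof.
by move=> DE; rewrite /jm -bigU //; apply: eq_bigl => j; rewrite inE.
Qed.

(** The sum of sgn(s) * \prod_(c cycle of s in U) (v * al_c + be_c) * s over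
    the permutations s of [U], where al_c and be_c are products over c.  Here
    the products are expanded: [D] is the union of the cycles for which the
    first term is chosen, and s is the product of a permutation of [D] and one
    of its complement. *)
Definition wcycsum U (al be : 'I_n -> K) (v : K) : A :=
  \sum_(D : {set 'I_n} | D \subset U)
    ((\prod_(i in D) al i) * (\prod_(i in U :\: D) be i))
      *: (cycsum D v * cycsum (U :\: D) 1).

Lemma big_subset_setU1 (V : nmodType) a U (F : {set 'I_n} -> V) : a \notin U ->
  \sum_(D : {set 'I_n} | D \subset a |: U) F D
  = \sum_(D : {set 'I_n} | D \subset U) F (a |: D)
    + \sum_(D : {set 'I_n} | D \subset U) F D.
Proof.
move=> aU; rewrite (bigID (fun D : {set 'I_n} => a \in D)) /=; congr (_ + _).
  rewrite (reindex_onto (fun D => a |: D) (fun D => D :\ a)) /=; last first.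
    by move=> D /andP[_ aD]; rewrite setD1K.
  apply: eq_bigl => D; rewrite setU11 andbT.
  apply/andP/idP => [[DU /eqP e]|DU].
    have aD : a \notin D by rewrite -e !inE eqxx.
    by rewrite -(setU1K aD) -(setU1K aU) setSD.
  have aD : a \notin D by apply: contra aU; apply: (subsetP DU).
  by rewrite setUS // setU1K ?eqxx.
apply: eq_bigl => D; apply/andP/idP => [[DU aD]|DU].
  by rewrite -(setU1K aU) subsetD1 DU.
split; first by apply: subset_trans DU (subsetUr _ _).
by apply: contra aU; apply: (subsetP DU).
Qed.

(** The coefficients of [al a] and [be a] in [wcycsum (a |: U) al be v]. *)
Definition wcycsum_al a U al be v : A :=
  \sum_(D : {set 'I_n} | D \subset U)
    ((\prod_(i in D) al i) * (\prod_(i in U :\: D) be i))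
      *: (cycsum (a |: D) v * cycsum (U :\: D) 1).

Definition wcycsum_be a U al be v : A :=
  \sum_(D : {set 'I_n} | D \subset U)
    ((\prod_(i in D) al i) * (\prod_(i in U :\: D) be i))
      *: (cycsum D v * cycsum (a |: U :\: D) 1).

Lemma wcycsum_setU1 a U al be v : a \notin U ->
  wcycsum (a |: U) al be v
  = al a *: wcycsum_al a U al be v + be a *: wcycsum_be a U al be v.
Proof.
move=> aU; rewrite /wcycsum big_subset_setU1 //.
rewrite /wcycsum_al /wcycsum_be !scaler_sumr; congr (_ + _).
  apply: eq_bigr => D DU.
  have aD : a \notin D by apply: contra aU; apply: (subsetP DU).
  have -> : (a |: U) :\: (a |: D) = U :\: D.
    apply/setP=> b; rewrite !inE; case: eqVneq => //= ->.
    by rewrite (negPf aU) andbF.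
  by rewrite big_setU1 //= scalerA mulrA.
apply: eq_bigr => D DU.
have aD : a \notin D by apply: contra aU; apply: (subsetP DU).
have -> : (a |: U) :\: D = a |: (U :\: D).
  by apply/setP=> b; rewrite !inE; case: eqVneq => //= ->; rewrite aD.
rewrite big_setU1 ?inE ?(negPf aU) ?andbF //= scalerA mulrCA.
by [].
Qed.

(** With both weights of [a] equal to 1, inserting [a] in an existing cycle
    does not change the weight of the cycle, while a cycle reduced to [a] has
    weight [v + 1]; this is how the recursion for [cycsum] appears with parameter
    [v + 1]. *)
Lemma wcycsum_lead a U al be v : a \notin U ->
  wcycsum_al a U al be v + wcycsum_be a U al be v
  = ((v + 1)%:A - jm a U) * wcycsum U al be v.
Proof.
move=> aU; rewrite -big_split /wcycsum mulr_sumr; apply: eq_bigr => D DU /=.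
have aD : a \notin D by apply: contra aU; apply: (subsetP DU).
have aE : a \notin U :\: D by rewrite inE (negPf aU) andbF.
have DE : [disjoint D & U :\: D].
  by rewrite -setI_eq0 setDE setICA setICr setI0.
have UE : U = D :|: (U :\: D) by rewrite -{1}(setID U D) (setIidPr DU).
rewrite -scalerDr -scalerAr; congr (_ *: _).
have -> : jm a U = jm a D + jm a (U :\: D) by rewrite {1}UE jmU.
rewrite !cycsum_rec // [X in _ + X]mulrA.
have -> : cycsum D v * (1%:A - jm a (U :\: D))
  = (1%:A - jm a (U :\: D)) * cycsum D v.
  rewrite mulrBl mulrBr scale1r mul1r mulr1; congr (_ - _).
  exact/esym/comm_jm_cycsum_disjoint.
rewrite -!mulrA -mulrDl; congr (_ * _).
by rewrite scalerDl opprD addrACA.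
Qed.

End CycleSum.

(** * Expansion of a determinant along two rows *)

Section RowReplacement.
Context (R : comNzRingType) (n : nat).
Implicit Types (M : 'M[R]_n) (r s : 'I_n -> R) (a b : 'I_n).

Definition unit_row a : 'I_n -> R := fun j => (j == a)%:R.

Definition repl_row M a r : 'M[R]_n :=
  \matrix_(i, j) if i == a then r j else M i j.

Definition det2 M a b r s : R := \det (repl_row (repl_row M b s) a r).

Lemma det_repl_row_lin M a r s x y :
  \det (repl_row M a (fun j => x * r j + y * s j))
  = x * \det (repl_row M a r) + y * \det (repl_row M a s).
Proof.
apply: (@determinant_multilinear _ _ _ _ _ a).
- by apply/rowP=> j; rewrite !mxE eqxx.
- by apply/matrixP=> i j; rewrite !mxE eq_sym (negPf (neq_lift _ _)).
- by apply/matrixP=> i j; rewrite !mxE eq_sym (negPf (neq_lift _ _)).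
Qed.

Lemma repl_row_id M a : repl_row M a (M a) = M.
Proof. by apply/matrixP=> i j; rewrite mxE; case: eqP => // ->. Qed.

Lemma repl_rowC M a b r s : a != b ->
  repl_row (repl_row M b s) a r = repl_row (repl_row M a r) b s.
Proof.
move=> ab; apply/matrixP=> i j; rewrite !mxE.
by case: (eqVneq i a) => [->|//]; rewrite (negPf ab).
Qed.

Lemma eq_det2 M a b r r' s s' : r =1 r' -> s =1 s' ->
  det2 M a b r s = det2 M a b r' s'.
Proof.
move=> er es; congr (\det _); apply/matrixP=> i j; rewrite !mxE.
by rewrite er es.
Qed.

Lemma det2_linl M a b r r' s x y :
  det2 M a b (fun j => x * r j + y * r' j) s
  = x * det2 M a b r s + y * det2 M a b r' s.
Proof. exact: det_repl_row_lin. Qed.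

Lemma det2_linr M a b r s s' x y : a != b ->
  det2 M a b r (fun j => x * s j + y * s' j)
  = x * det2 M a b r s + y * det2 M a b r s'.
Proof. by move=> ab; rewrite /det2 !(repl_rowC _ _ _ ab) det_repl_row_lin. Qed.

Lemma det2_same M a b r : a != b -> det2 M a b r r = 0.
Proof.
move=> ab; apply: (determinant_alternate ab) => j.
by rewrite !mxE eqxx eq_sym (negPf ab) eqxx.
Qed.

Lemma det2_anti M a b r s : a != b -> det2 M a b r s = - det2 M a b s r.
Proof.
move=> ab; apply/eqP; rewrite -addr_eq0; apply/eqP.
have := det2_same M (fun j => 1 * r j + 1 * s j) ab.
rewrite det2_linl !det2_linr // !det2_same // !mul1r add0r addr0.
by [].
Qed.

Lemma det2_id M a b : det2 M a b (M a) (M b) = \det M.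
Proof. by rewrite /det2 repl_row_id repl_row_id. Qed.

Lemma det_expand_unit_rows M a :
  \det M = \sum_j M a j * \det (repl_row M a (unit_row j)).
Proof.
rewrite (expand_det_row _ a); apply: eq_bigr => j _; congr (_ * _).
rewrite (expand_det_row _ a) (bigD1 j) //= big1 => [|k kj].
  rewrite !mxE eqxx /unit_row eqxx mul1r addr0 /cofactor; congr (_ * \det _).
  by apply/matrixP=> i k; rewrite !mxE eq_sym (negPf (neq_lift _ _)).
by rewrite !mxE eqxx /unit_row (negPf kj) mul0r.
Qed.

Definition det_diffcol M a b r (d : 'I_n -> R) : R :=
  \det (\matrix_(i, j) if j == b then (if (i == a) || (i == b) then 0 else d i)
                       else if i == a then unit_row a j
                       else if i == b then r j else M i j).

(** If the columns [a] and [b] agreed outside the rows [a] and [b], exchanging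
    them would turn the second determinant into the opposite of the first.  They
    differ there by [e * d], so the sum is divisible by [e]. *)
Lemma det2_diffcol M a b r d e : a != b -> r a = 0 -> r b = 0 ->
  (forall i, i != a -> i != b -> M i b = M i a - e * d i) ->
  det2 M a b (unit_row a) r + det2 M a b (unit_row b) r
  = - e * det_diffcol M a b r d.
Proof.
move=> ab ra rb Mab.
have := det2_linl M a b (unit_row a) (unit_row b) r 1 1; rewrite !mul1r => <-.
pose P := repl_row (repl_row M b r) a (fun j => 1 * unit_row a j + 1 * unit_row b j).
rewrite /det2 -/P -det_tr /det_diffcol -[in RHS]det_tr.
set Q := (X in _ = _ * \det X).
pose W : 'M[R]_n := \matrix_(j, i) if j == b then P i a else P i j.
have W0 : \det W = 0.
  apply: (determinant_alternate ab) => i; rewrite !mxE eqxx.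
  by rewrite (negPf ab).
rewrite (@determinant_multilinear _ _ _ W Q b 1 (- e)).
- by rewrite W0 mulr0 add0r -?mulrA.
- apply/rowP=> i; rewrite !mxE eqxx.
  case: (eqVneq i a) => [->|ia] /=.
    by rewrite /unit_row !eqxx eq_sym (negPf ab) /=; ring.
  case: (eqVneq i b) => [_|ib] /=; first by rewrite ra rb; ring.
  by rewrite Mab //; ring.
- by apply/matrixP=> i j; rewrite !mxE eq_sym (negPf (neq_lift _ _)).
- apply/matrixP=> i j; rewrite !mxE eq_sym (negPf (neq_lift _ _)).
  case: (eqVneq j a) => // _.
  by rewrite /unit_row [lift b i == b]eq_sym (negPf (neq_lift _ _)) mulr0 addr0 mul1r.
Qed.

(** Here [e] is the difference of two colliding points, [k] is its inverse, and
    [ra], [rb], [t], [d] are regular.  The poles remain only in the coefficient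
    of the minor without the rows and columns [a] and [b], and in [xa] and [xb]. *)
Lemma det_two_rows M a b ga gb ma mb xa xb k e ra rb t d :
  a != b -> e * k = 1 ->
  (forall j, M a j = (ma + ga * xa) * unit_row a j
                     + (ga * k) * unit_row b j + ga * ra j) ->
  (forall j, M b j = (mb + gb * xb) * unit_row b j
                     - (gb * k) * unit_row a j + gb * rb j) ->
  rb a = 0 -> rb b = 0 ->
  (forall j, ra j = rb j - e * t j) ->
  (forall i, i != a -> i != b -> M i b = M i a - e * d i) ->
  let ua := unit_row a in let ub := unit_row b in
  let Om := det2 M a b in
  \det M =
    ((ma + ga * xa) * (mb + gb * xb) + ga * gb * (k * k)) * Om ua ub
    + ma * gb * Om ua rb + ga * mb * Om ra ub
    + ga * gb * (xa * Om ua rb - xb * Om ub rb + e * xb * Om ub t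
                 - det_diffcol M a b rb d - Om ua t)
    + ga * gb * Om ra rb.
Proof.
move=> ab ek Ma Mb rba rbb era Md ua ub Om.
have oD : Om ua rb + Om ub rb = - e * det_diffcol M a b rb d.
  exact: det2_diffcol.
have Oara s : Om ra s = Om rb s - e * Om t s.
  rewrite /Om (@eq_det2 _ _ _ ra (fun j => 1 * rb j + (- e) * t j) s s) //.
    by rewrite det2_linl; ring.
  by move=> j; rewrite era; ring.
have anti r s : Om r s = - Om s r by exact: det2_anti.
have same r : Om r r = 0 by exact: det2_same.
have linl x y r r' s : Om (fun j => x * r j + y * r' j) s = x * Om r s + y * Om r' s.
  exact: det2_linl.
have linr x y r s s' : Om r (fun j => x * s j + y * s' j) = x * Om r s + y * Om r s'.
  exact: det2_linr.
have eM : \det M =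
   Om (fun j => 1 * ((ma + ga * xa) * ua j + (ga * k) * ub j) + ga * ra j)
      (fun j => 1 * ((mb + gb * xb) * ub j + (- (gb * k)) * ua j) + gb * rb j).
  rewrite -(det2_id M a b); apply: eq_det2 => j; rewrite ?Ma ?Mb /ua /ub; ring.
rewrite eM !(linl, linr) !same (anti ub ua) (anti ra ua) (anti ra ub).
rewrite (anti ua ra) (anti ub ra) !Oara (anti rb ua) (anti rb ub) (anti t ua)
  (anti t ub) (anti t rb) !same.
have Ob : Om ub rb = - e * det_diffcol M a b rb d - Om ua rb.
  by rewrite -oD; ring.
rewrite Ob.
move: (Om ua ub) (Om ua rb) (Om ua t) (Om ub t) (Om rb t)
  (det_diffcol M a b rb d) => o1 o2 o3 o4 o5 o6.
have {}ek : k * e = 1 by rewrite mulrC.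
ring: ek.
Qed.

End RowReplacement.

(** * Ring relations, Leibniz expansions and substitution *)

Section RingRel.

(** A subring of [R * S], seen as a relation.  The relations of use are the
    specializations of rational functions; a relation that ignores its second
    argument is a predicate that defines a subring of [R]. *)
Record ring_rel (R S : pzRingType) (P : R -> S -> Prop) : Prop := RingRel {
  rrel1 : P 1 1;
  rrelB : forall x y x' y', P x x' -> P y y' -> P (x - y) (x' - y');
  rrelM : forall x y x' y', P x x' -> P y y' -> P (x * y) (x' * y') }.

Section Closure.
Context (R S : pzRingType) (P : R -> S -> Prop) (PP : ring_rel P).

Lemma rrel0 : P 0 0.
Proof. by rewrite -(subrr (1 : R)) -(subrr (1 : S)); apply: (rrelB PP); apply: (rrel1 PP). Qed.

Lemma rrelN x x' : P x x' -> P (- x) (- x').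
Proof. by move=> Px; rewrite -sub0r -[- x']sub0r; apply: (rrelB PP) => //; apply: rrel0. Qed.

Lemma rrelD x y x' y' : P x x' -> P y y' -> P (x + y) (x' + y').
Proof.
by move=> Px Py; rewrite -[y]opprK -[y']opprK; apply: (rrelB PP) => //; apply: rrelN.
Qed.

Lemma rrel_sum (I : Type) (r : seq I) (Q : pred I) F F' :
  (forall i, Q i -> P (F i) (F' i)) ->
  P (\sum_(i <- r | Q i) F i) (\sum_(i <- r | Q i) F' i).
Proof.
by move=> PF; elim/big_ind2: _ => //; [apply: rrel0 | move=> *; apply: rrelD].
Qed.

Lemma rrel_prod (I : Type) (r : seq I) (Q : pred I) F F' :
  (forall i, Q i -> P (F i) (F' i)) ->
  P (\prod_(i <- r | Q i) F i) (\prod_(i <- r | Q i) F' i).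
Proof.
by move=> PF; elim/big_ind2: _ => //; [apply: (rrel1 PP) | move=> *; apply: (rrelM PP)].
Qed.

Lemma rrelX k x x' : P x x' -> P (x ^+ k) (x' ^+ k).
Proof.
by move=> Px; elim: k => [|k IH]; rewrite ?expr0 ?exprS;
  [apply: (rrel1 PP) | apply: (rrelM PP)].
Qed.

Lemma rrel_sign k : P ((-1) ^+ k) ((-1) ^+ k).
Proof. by apply/rrelX/rrelN/(rrel1 PP). Qed.

Lemma rrel_nat k : P k%:R k%:R.
Proof.
by elim: k => [|k IH]; [apply: rrel0 | rewrite !mulrS; apply: rrelD => //; apply: (rrel1 PP)].
Qed.

Lemma eq_rrel x y x' y' : P x x' -> x = y -> x' = y' -> P y y'.
Proof. by move=> Px <- <-. Qed.

End Closure.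

Definition galg_rel (R S : comNzRingType) (P : R -> S -> Prop) (gT : finGroupType)
  (x : galg R gT) (y : galg S gT) : Prop := forall g, P (x g) (y g).

Section Lift.
Context (R S : comNzRingType) (P : R -> S -> Prop) (PP : ring_rel P).
Context (gT : finGroupType).
Local Notation PA := (@galg_rel R S P gT).

Lemma galg_rel_base g : PA (gbase R g) (gbase S g).
Proof. by move=> h; rewrite !ffunE; apply: (rrel_nat PP). Qed.

Lemma galg_ring_rel : ring_rel PA.
Proof.
split=> [|x y x' y' Px Py g|x y x' y' Px Py g]; first exact: galg_rel_base.
  by rewrite !ffunE; apply: (rrelB PP).
by rewrite !ffunE; apply: (rrel_sum PP) => // h _; apply: (rrelM PP).
Qed.

Lemma galg_relZ c c' x x' : P c c' -> PA x x' -> PA (c *: x) (c' *: x').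
Proof. by move=> Pc Px g; rewrite !ffunE; apply: (rrelM PP). Qed.

Lemma galg_relA c c' : P c c' -> PA c%:A c'%:A.
Proof. by move=> Pc; apply: galg_relZ => //; apply: galg_rel_base. Qed.
End Lift.

End RingRel.

(** The entries need not commute: each term of the Leibniz expansion is
    multiplied in the order of the rows. *)
Definition ncdet (R : pzRingType) n (M : 'I_n -> 'I_n -> R) : R :=
  \sum_(s : 'S_n) (-1) ^+ s * \prod_i M i (s i).

Lemma eq_ncdet (R : pzRingType) n (M M' : 'I_n -> 'I_n -> R) : M =2 M' -> ncdet M = ncdet M'.
Proof.
by move=> e; apply: eq_bigr => s _; congr (_ * _); apply: eq_bigr => i _.
Qed.

Lemma ncdet_rel (R S : pzRingType) (P : R -> S -> Prop) n
    (M : 'I_n -> 'I_n -> R) (M' : 'I_n -> 'I_n -> S) :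
  ring_rel P -> (forall i j, P (M i j) (M' i j)) -> P (ncdet M) (ncdet M').
Proof.
move=> PP PM; apply: (rrel_sum PP) => // s _; apply: (rrelM PP) => //.
  exact: (rrel_sign PP).
by apply: (rrel_prod PP).
Qed.

Section Substitution.
Context (K : comNzRingType) (A : algType K) (n : nat) (H : 'I_n -> A).

Definition ev (p : {mpoly K[n]}) : A := mmap (in_alg A) H p.

Lemma evD p q : ev (p + q) = ev p + ev q. Proof. exact: mmapD. Qed.
Lemma evN p : ev (- p) = - ev p. Proof. exact: mmapN. Qed.
Lemma ev0 : ev 0 = 0. Proof. exact: mmap0. Qed.
Lemma evC c : ev c%:MP = c%:A. Proof. by rewrite /ev mmapC. Qed.
Lemma ev1 : ev 1 = 1. Proof. by rewrite -mpolyC1 evC scale1r. Qed.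
Lemma evX i : ev 'X_i = H i. Proof. by rewrite /ev mmapX mmap1U. Qed.

Lemma ev_sum (I : Type) (r : seq I) (Q : pred I) F :
  ev (\sum_(i <- r | Q i) F i) = \sum_(i <- r | Q i) ev (F i).
Proof. by apply: big_morph; [apply: evD | apply: ev0]. Qed.

Hypothesis Hcomm : forall i j, GRing.comm (H i) (H j).

(** The values [H i] commute with each other, although not with all of [A];
    this is enough for the substitution to be multiplicative. *)
Lemma mmap1D_comm m1 m2 : mmap1 H (m1 + m2) = mmap1 H m1 * mmap1 H m2.
Proof.
rewrite /mmap1.
have -> : \prod_i H i ^+ (m1 + m2)%MM i
  = \prod_i (H i ^+ m1 i * H i ^+ m2 i).
  by apply: eq_bigr => i _; rewrite mnmDE exprD.
elim: (index_enum _) => [|i r IH]; first by rewrite !big_nil mulr1.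
rewrite !big_cons IH -!mulrA; congr (_ * _); rewrite !mulrA; congr (_ * _).
apply/esym/commr_sym/commr_prod => j _; apply: commrX.
by apply/commr_sym/commrX/Hcomm.
Qed.

Lemma evM p q : ev (p * q) = ev p * ev q.
Proof.
pose_big_enough i.
  rewrite (mpolywME (k := i)) // ev_sum /ev !(mmapE i) //.
  rewrite big_distrlr /= pair_bigA; apply/eq_bigr=> /=.
  case=> j1 j2 _ /=; rewrite mmapZ mmapX mmap1D_comm /=.
  by rewrite -!scalerAl -!scalerAr !mul1r scalerA.
by close.
Qed.

Lemma ev_prod (I : Type) (r : seq I) (Q : pred I) F :
  ev (\prod_(i <- r | Q i) F i) = \prod_(i <- r | Q i) ev (F i).
Proof. by apply: big_morph; [apply: evM | apply: ev1]. Qed.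

Lemma evX_exp p k : ev (p ^+ k) = ev p ^+ k.
Proof. by elim: k => [|k IH]; rewrite ?ev1 // !exprS evM IH. Qed.

Lemma ev_det (M : 'M[{mpoly K[n]}]_n) : ev (\det M) = ncdet (fun i j => ev (M i j)).
Proof.
rewrite /determinant ev_sum; apply: eq_bigr => s _.
by rewrite evM evX_exp evN ev1 ev_prod.
Qed.

End Substitution.

(** * Commutation of the KZ elements *)

Section Gaudin.
Context (K : fieldType) (n : nat).
Local Notation A := (galg K 'S_n).
Local Notation transp := (transp K).
Implicit Types (a b : 'I_n) (N U V : {set 'I_n}) (z m g : 'I_n -> K).

Definition kz_on V z a : A := \sum_(c in V) (z a - z c)^-1 *: transp a c.

Definition kz N U z a : A := if a \in N then kz_on (U :\ a) z a else 0.

Lemma kz_on_split U z a b : b \in U -> b != a ->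
  kz_on (U :\ a) z a
  = (z a - z b)^-1 *: transp a b + kz_on (U :\ a :\ b) z a.
Proof. by move=> bU ba; rewrite /kz_on (big_setD1 b) // !inE ba. Qed.

Lemma comm_kz_on V z a b : a != b -> a \notin V -> b \notin V ->
  kz_on V z a * kz_on V z b - kz_on V z b * kz_on V z a
  = \sum_(c in V) ((z a - z c)^-1 * (z b - z c)^-1) *:
      (transp a c * transp b c - transp b c * transp a c).
Proof.
move=> ab aV bV; rewrite /kz_on mulr_suml mulr_sumr -sumrB.
apply: eq_bigr => c cV.
have ac : a != c by apply: contraNneq aV => ->.
have bc : b != c by apply: contraNneq bV => ->.
rewrite mulr_sumr mulr_suml -sumrB (bigD1 c) //= big1 => [|d /andP[dV dc]].
  rewrite -!scalerAl -!scalerAr !scalerA addr0 scalerBr.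
  by rewrite [(z b - z c)^-1 * _]mulrC.
have ad : a != d by apply: contraNneq aV => ->.
have bd : b != d by apply: contraNneq bV => ->.
rewrite -!scalerAl -!scalerAr !scalerA [(z b - z d)^-1 * _]mulrC.
by rewrite transp_comm ?subrr // eq_sym.
Qed.

(** Pairs of terms on four distinct indices commute.  On three indices [a], [b],
    [c] all products of two transpositions are equal to one of two 3-cycles, and
    the coefficient of their difference is
    1/((z_a-z_b)(z_a-z_c)) - 1/((z_a-z_b)(z_b-z_c)) + 1/((z_a-z_c)(z_b-z_c)) = 0. *)
Lemma kz_comm N U z : N \subset U ->
  (forall a b, a \in N -> b \in U -> a != b -> z a != z b) ->
  forall a b, GRing.comm (kz N U z a) (kz N U z b).
Proof.
move=> NU zI a b; rewrite /kz.
case: ifP => [aN|_]; last exact/commr_sym/commr0.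
case: ifP => [bN|_]; last exact/commr0.
have [->|ab] := eqVneq a b; first exact: commr_refl.
have ba : b != a by rewrite eq_sym.
have aU := subsetP NU a aN; have bU := subsetP NU b bN.
rewrite (kz_on_split z bU ba) (kz_on_split z aU ab) setDDl setUC -setDDl.
set V := U :\ b :\ a; set s := transp a b; rewrite -[transp b a]transp_sym -/s.
have aV : a \notin V by rewrite !inE eqxx.
have bV : b \notin V by rewrite !inE eqxx andbF.
set Ra := kz_on V z a; set Rb := kz_on V z b.
pose k := (z a - z b)^-1.
have -> : (z b - z a)^-1 = - k by rewrite /k -invrN opprB.
rewrite -/k.
have e : k *: (s * Rb - Ra * s + s * Ra - Rb * s) + (Ra * Rb - Rb * Ra) = 0.
  rewrite comm_kz_on // /Ra /Rb /kz_on !(mulr_suml, mulr_sumr).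
  rewrite -sumrB -big_split -sumrB scaler_sumr -big_split big1 //= => c cV.
  have ac : a != c by apply: contraNneq aV => ->.
  have bc : b != c by apply: contraNneq bV => ->.
  have cb : c != b by rewrite eq_sym.
  have cU : c \in U by move: cV; rewrite !inE => /and3P[].
  rewrite -!scalerAl -!scalerAr /s.
  have p1 : transp a b * transp a c = transp a c * transp b c by apply: transp_braidl.
  have p2 : transp a c * transp b c = transp b c * transp a b by apply: transp_braidr.
  have q1 : transp a c * transp a b = transp a b * transp b c.
    by rewrite (transp_braidl _ ac cb) (transp_sym _ c b).
  have q2 : transp b c * transp a c = transp a c * transp a b.
    by rewrite (transp_braidr _ ba bc) (transp_sym _ b a).
  rewrite q2 p2 -q1 -p2 p1.
  move: (transp a c * transp b c) (transp a c * transp a b) => p q.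
  have zab : z a - z b != 0 by rewrite subr_eq0 zI.
  have zac : z a - z c != 0 by rewrite subr_eq0 zI.
  have zbc : z b - z c != 0 by rewrite subr_eq0 zI.
  apply/ffunP=> h; rewrite !ffunE /k; field.
  by rewrite zab zac zbc.
apply/eqP; rewrite -subr_eq0 -e; apply/eqP.
rewrite !mulrDl !mulrDr !scaleNr !mulNr !mulrN -!scalerAl -!scalerAr.
move: (s * s) (s * Rb) (Ra * s) (s * Ra) (Rb * s) (Ra * Rb) (Rb * Ra) => x1 x2 x3 x4 x5 x6 x7.
by apply/ffunP=> h; rewrite !ffunE; ring.
Qed.

(** The rows outside [N] are those of the identity, so that the determinant is
    the minor indexed by [N] while the size of the matrix stays fixed in
    inductions on [N]. *)
Definition gaudin_mx N U m g z : 'M[{mpoly K[n]}]_n :=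
  \matrix_(i, j)
    if i \in N then
      if i == j then (m i)%:MP + (g i)%:MP * 'X_i
      else if j \in U then (g i / (z i - z j))%:MP else 0
    else (i == j)%:R.

Definition gaudin_ent N U m g z (h : 'I_n -> A) i j : A :=
  if i \in N then
    if i == j then (m i)%:A + g i *: h i
    else if j \in U then (g i / (z i - z j))%:A else 0
  else (i == j)%:R.

Lemma ev_gaudin_ent N U m g z (h : 'I_n -> A) i j :
  (forall i j, GRing.comm (h i) (h j)) ->
  ev h (gaudin_mx N U m g z i j) = gaudin_ent N U m g z h i j.
Proof.
move=> hC; rewrite mxE /gaudin_ent; case: ifP => _; last first.
  by case: eqP => _; rewrite ?ev1 ?ev0.
case: ifP => _; last by case: ifP => _; rewrite ?ev0 ?evC.
by rewrite evD evM // !evC evX -scalerAl mul1r.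
Qed.

End Gaudin.

(** * Cancellation of the poles *)

Section PoleCancellation.
Context (K : fieldType) (gT : finGroupType).
Local Notation A := (galg K gT).
Implicit Types (s p q x : A) (c k e : K).

(** The double pole disappears because a transposition is an involution; the
    simple one is left with coefficients [mb * ga - ma * gb] and
    [s * q - p * s], both of which are divisible by the difference of the two
    points. *)
Lemma pole_cancel1 ma mb ga gb k p q s : s * s = 1 ->
  (ma%:A + ga%:A * (k *: s + p)) * (mb%:A + gb%:A * (- k *: s + q))
    + ga%:A * gb%:A * (k%:A * k%:A)
  = (ma * mb)%:A + (ma * gb) *: q + (mb * ga) *: p
    + (k * (mb * ga - ma * gb)) *: s + (ga * gb) *: (p * q)
    + (ga * gb) *: (k *: (s * q - p * s)) :> A.
Proof.
move=> ss; rewrite !mulr_algl !(mulrDl, mulrDr) -!scalerAl -!scalerAr.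
rewrite !mulrDr !mulrDl !mul1r ?mulr1 -!scalerAl -!scalerAr ss.
rewrite ?(mulr1, mul1r).
move: (1 : A) (s * q) (p * s) (p * q) => o x1 x2 x3.
by apply/ffunP=> h; rewrite !ffunE; ring.
Qed.

Lemma pole_cancel2 k e p q s (x1 x2 x4 x5 x7 : A) :
  k * e = 1 -> x1 + x2 = - (e *: x7) ->
  (k *: s + p) * x1 - (- k *: s + q) * x2 + e%:A * (- k *: s + q) * x4 - x7 - x5
  = - (s * x7) + p * x1 - q * x2 - s * x4 + e *: (q * x4) - x7 - x5.
Proof.
move=> ek e12; rewrite mulr_algl !(mulrDl, scalerDr) -!scalerAl.
have -> : s * x7 = - (k *: (s * x1)) - k *: (s * x2).
  rewrite -opprD -scalerDr -mulrDr e12 mulrN scalerN opprK -scalerAr scalerA ek.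
  by rewrite scale1r.
move: (s * x1) (p * x1) (s * x2) (q * x2) (s * x4) (q * x4) => y1 y2 y3 y4 y5 y6.
by apply/ffunP=> h; rewrite !ffunE; ring: ek.
Qed.

End PoleCancellation.

Section NoPole.
Context (K : fieldType) (n : nat).
Local Notation A := (galg K 'S_n).
Local Notation transp := (transp K).
Context (Q : K -> Prop) (QQ : ring_rel (fun x (_ : K) => Q x)).
Let QA (x : A) := @galg_rel K K (fun y _ => Q y) 'S_n x x.
Context (N U : {set 'I_n}) (m g z : 'I_n -> K) (a b : 'I_n).
Hypothesis NU : N \subset U.
Hypothesis zI : forall i j, i \in N -> j \in U -> i != j -> z i != z j.
Hypotheses (aN : a \in N) (bN : b \in N) (ab : a != b).
Hypothesis Qm : forall i, i \in N -> Q (m i).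
Hypothesis Qg : forall i, i \in N -> Q (g i).
Hypothesis Qab : Q (z a - z b).
Hypothesis Qmg : Q ((g a * m b - g b * m a) / (z a - z b)).
Hypothesis Qz : forall i j, i \in N -> j \in U -> i != j ->
  ~~ ((i == a) && (j == b)) -> ~~ ((i == b) && (j == a)) -> Q (z i - z j)^-1.

Let H := kz N U z.
Let Hcomm : forall i j, GRing.comm (H i) (H j) := kz_comm NU zI.
Let V := U :\ a :\ b.
Let QR := galg_ring_rel QQ 'S_n.

Let aU : a \in U := subsetP NU a aN.
Let bU : b \in U := subsetP NU b bN.
Let ba : b != a. Proof. by rewrite eq_sym. Qed.

Let QAscal c : Q c -> QA c%:A.
Proof. by move=> Qc; apply: (@galg_relA _ _ _ QQ 'S_n c c Qc). Qed.

Let QAtransp i j : QA (transp i j).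
Proof. exact: (galg_rel_base QQ). Qed.

Let QVa c : c \in V -> Q (z a - z c)^-1.
Proof.
rewrite !inE => /and3P[cb ca cU]; apply: Qz => //; first by rewrite eq_sym.
  by rewrite (negPf cb) andbF.
by rewrite (negPf ab).
Qed.

Let QVb c : c \in V -> Q (z b - z c)^-1.
Proof.
rewrite !inE => /and3P[cb ca cU]; apply: Qz => //; first by rewrite eq_sym.
  by rewrite (negPf ba).
by rewrite (negPf ca) andbF.
Qed.

Let QAkz_on i (V' : {set 'I_n}) : (forall c, c \in V' -> Q (z i - z c)^-1) -> QA (kz_on V' z i).
Proof.
move=> Qi; apply: (rrel_sum QR) => c cV.
by apply: (galg_relZ QQ); [apply: Qi | apply: QAtransp].
Qed.

Let QAH i : i != a -> i != b -> QA (H i).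
Proof.
move=> ia ib; rewrite /H /kz; case: ifP => iN; last exact: (rrel0 QR).
apply: QAkz_on => c; rewrite !inE => /andP[ci cU].
by apply: Qz => //; rewrite ?(negPf ia) ?(negPf ib) // eq_sym.
Qed.

Local Notation M := (gaudin_mx N U m g z).

Let QAent i j : i != a -> i != b -> QA (ev H (M i j)).
Proof.
move=> ia ib; rewrite ev_gaudin_ent // /gaudin_ent.
case: ifP => iN; last by case: eqP => _; [apply: (rrel1 QR)|apply: (rrel0 QR)].
case: ifP => ij.
  by apply: (rrelD QR); [apply/QAscal/Qm | apply: (galg_relZ QQ); [apply: Qg|apply: QAH]].
case: ifP => jU; last exact: (rrel0 QR).
apply: QAscal; apply: (rrelM QQ (x' := 0) (y' := 0)); first exact: Qg.
by apply: Qz; rewrite ?ij ?(negPf ia) ?(negPf ib).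
Qed.

Let QAunit (i j : 'I_n) : QA (ev H (unit_row _ i j)).
Proof.
by rewrite /unit_row; case: eqP => _; rewrite ?ev1 ?ev0;
  [apply: (rrel1 QR)|apply: (rrel0 QR)].
Qed.

Let QAdet2 r s : (forall j, QA (ev H (r j))) -> (forall j, QA (ev H (s j))) ->
  QA (ev H (det2 M a b r s)).
Proof.
move=> Qr Qs; rewrite /det2 ev_det //; apply: (ncdet_rel QR) => i j.
rewrite /repl_row mxE; case: eqVneq => ia; first exact: Qr.
rewrite mxE; case: eqVneq => ib; first exact: Qs.
exact: QAent.
Qed.

Let row_at (f : 'I_n -> K) : 'I_n -> {mpoly K[n]} := fun j =>
  if j \in V then (f j)%:MP else 0.

Let QArow f : (forall j, j \in V -> Q (f j)) -> forall j, QA (ev H (row_at f j)).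
Proof.
move=> Qf j; rewrite /row_at; case: ifP => jV; rewrite ?ev0 ?evC.
  exact/QAscal/Qf.
exact: (rrel0 QR).
Qed.

Let ra := row_at (fun j => (z a - z j)^-1).
Let rb := row_at (fun j => (z b - z j)^-1).
Let t := row_at (fun j => (z a - z j)^-1 * (z b - z j)^-1).
Let d : 'I_n -> {mpoly K[n]} := fun i =>
  if i \in N then (g i * ((z i - z a)^-1 * (z i - z b)^-1))%:MP else 0.
Let eps := z a - z b.
Let k := eps^-1.
Let eps0 : eps != 0. Proof. by rewrite subr_eq0 zI. Qed.

Let QAd : QA (ev H (det_diffcol M a b rb d)).
Proof.
rewrite ev_det //; apply: (ncdet_rel QR) => i j; rewrite mxE.
case: ifP => _.
  case: ifPn => [_|]; first by rewrite ev0; apply: (rrel0 QR).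
  rewrite negb_or => /andP[ia ib]; rewrite /d; case: ifP => iN; last first.
    by rewrite ev0; apply: (rrel0 QR).
  rewrite evC; apply: QAscal; apply: (rrelM QQ (x' := 0) (y' := 0)); first exact: Qg.
  apply: (rrelM QQ (x' := 0) (y' := 0)).
    by apply: Qz; rewrite ?(negPf ia) ?(negPf ib).
  by apply: Qz; rewrite ?(negPf ia) ?(negPf ib).
case: eqVneq => ia; first exact: QAunit.
case: eqVneq => ib; last exact: QAent.
exact: QArow.
Qed.

Let s := transp a b.
Let Ra := kz_on V z a.
Let Rb := kz_on V z b.

Let Ha : H a = k *: s + Ra.
Proof. by rewrite /H /kz aN (kz_on_split z bU ba). Qed.

Let Hb : H b = - k *: s + Rb.
Proof.
rewrite /H /kz bN (kz_on_split z aU ab) setDDl setUC -setDDl.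
by rewrite -[transp b a]transp_sym /k -invrN /eps opprB.
Qed.

(** Conjugation by [s] turns the regular part [Ra] of [H a] into that of [H b]
    evaluated at [z a] instead of [z b], so the commutator-like difference has a
    factor [z a - z b]. *)
Let twist : k *: (s * Rb - Ra * s)
  = \sum_(c in V) ((z a - z c)^-1 * (z b - z c)^-1) *: (s * transp b c).
Proof.
rewrite /Ra /Rb /kz_on mulr_sumr mulr_suml -sumrB scaler_sumr.
apply: eq_bigr => c; rewrite !inE => /and3P[cb ca cU].
have ac : a != c by rewrite eq_sym.
have bc : b != c by rewrite eq_sym.
rewrite -scalerAr -scalerAl /s (transp_braidl _ ac cb) (transp_sym _ c b).
rewrite -scalerBl scalerA; congr (_ *: _); rewrite /k /eps; field.
by rewrite !subr_eq0 !zI.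
Qed.

(** [Q] is to be read as regularity at [z a = z b], which holds for all entries
    but those on the rows [a] and [b].  [det_two_rows] isolates the singular
    terms: the product of the two diagonal entries is handled by [pole_cancel1]
    and the terms that involve a third column by [pole_cancel2]. *)
Lemma gaudin_no_pole : QA (ev H (\det M)).
Proof.
have ek : eps%:MP_[n] * k%:MP = 1 by rewrite -mpolyCM mulfV.
have era j : ra j = rb j - eps%:MP * t j.
  rewrite /ra /rb /t /row_at; case: ifP => [|_]; last by rewrite mulr0 subr0.
  rewrite !inE => /and3P[cb ca cU].
  rewrite -mpolyCM -mpolyCB; congr (_%:MP); rewrite /eps; field.
  by rewrite !subr_eq0 !zI // eq_sym.
have Md i : i != a -> i != b -> M i b = M i a - eps%:MP * d i.
  move=> ia ib; rewrite !mxE /d (negPf ia) (negPf ib) aU bU.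
  case: ifP => iN; last by rewrite mulr0 subr0.
  rewrite -mpolyCM -mpolyCB; congr (_%:MP); rewrite /eps; field.
  by rewrite !subr_eq0 !zI.
have Ma j : M a j = ((m a)%:MP + (g a)%:MP * 'X_a) * unit_row _ a j
    + ((g a)%:MP * k%:MP) * unit_row _ b j + (g a)%:MP * ra j.
  rewrite !mxE aN /unit_row /ra /row_at !inE eq_sym.
  case: (eqVneq j a) => [->|ja]; first by rewrite ?(negPf ab) /= ?andbF !(mulr0, mulr1, addr0).
  case: (eqVneq j b) => [->|jb] /=.
    by rewrite bU !(mulr0, mulr1, addr0, add0r) mpolyCM.
  by case: ifP; rewrite !(mulr0, mulr1, addr0, add0r) ?mpolyCM.
have Mb j : M b j = ((m b)%:MP + (g b)%:MP * 'X_b) * unit_row _ b j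
    - ((g b)%:MP * k%:MP) * unit_row _ a j + (g b)%:MP * rb j.
  rewrite !mxE bN /unit_row /rb /row_at !inE eq_sym.
  case: (eqVneq j b) => [->|jb]; first by rewrite (negPf ba) /= !(mulr0, mulr1, addr0, subr0).
  case: (eqVneq j a) => [->|ja] /=.
    by rewrite aU !(mulr0, mulr1, addr0, add0r) -mpolyCM -mpolyCN -mulrN /k -invrN opprB.
  by case: ifP; rewrite !(mulr0, mulr1, oppr0, addr0, add0r, subr0) ?mpolyCM.
have rba : rb a = 0 by rewrite /rb /row_at !inE eqxx andbF.
have rbb : rb b = 0 by rewrite /rb /row_at !inE eqxx.
have := det_two_rows ab ek Ma Mb rba rbb era Md.
move=> /= ->.
have := congr1 (ev H) (det2_diffcol ab rba rbb Md).
rewrite mulNr evD evN (evM Hcomm) evC -scalerAl mul1r.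
have Qra : forall j, QA (ev H (ra j)) by exact: (QArow QVa).
have Qrb : forall j, QA (ev H (rb j)) by exact: (QArow QVb).
have Qt : forall j, QA (ev H (t j)).
  apply: QArow => i iV; apply: (rrelM QQ (x' := 0) (y' := 0)).
    exact: QVa.
  exact: QVb.
have QX0 := QAdet2 (QAunit a) (QAunit b).
have QX1 := QAdet2 (QAunit a) Qrb.
have QX2 := QAdet2 (QAunit b) Qrb.
have QX3 := QAdet2 Qra (QAunit b).
have QX4 := QAdet2 (QAunit b) Qt.
have QX5 := QAdet2 (QAunit a) Qt.
have QX6 := QAdet2 Qra Qrb.
have QX7 := QAd.
move: QX0 QX1 QX2 QX3 QX4 QX5 QX6 QX7.
move: (det2 M a b (unit_row _ a) (unit_row _ b)) => p0.
move: (det2 M a b (unit_row _ a) rb) => p1.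
move: (det2 M a b (unit_row _ b) rb) => p2.
move: (det2 M a b ra (unit_row _ b)) => p3.
move: (det2 M a b (unit_row _ b) t) => p4.
move: (det2 M a b (unit_row _ a) t) => p5.
move: (det2 M a b ra rb) => p6.
move: (det_diffcol M a b rb d) => p7.
rewrite !(evD, evN, evM Hcomm, evC, evX).
move: (ev H p0) (ev H p1) (ev H p2) (ev H p3) (ev H p4) (ev H p5) (ev H p6) (ev H p7).
move=> X0 X1 X2 X3 X4 X5 X6 X7 QX0 QX1 QX2 QX3 QX4 QX5 QX6 QX7 eX.
rewrite !Ha !Hb.
have ek' : k * eps = 1 by apply: mulVf.
rewrite (pole_cancel1 _ _ _ _ _ _ _ (transp_sqr K a b)) (pole_cancel2 _ _ _ _ _ ek' eX).
have Qs : QA s by apply: QAtransp.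
have QRa : QA Ra by apply: QAkz_on.
have QRb : QA Rb by apply: QAkz_on.
have QZ c x : Q c -> QA x -> QA (c *: x) by move=> Qc Qx; apply: (galg_relZ QQ).
have QM c c' : Q c -> Q c' -> Q (c * c').
  by move=> Qc Qc'; apply: (rrelM QQ (x' := 0) (y' := 0)).
have QD x y : QA x -> QA y -> QA (x + y) by apply: (rrelD QR).
have QN x : QA x -> QA (- x) by apply: (rrelN QR).
have QMA x y : QA x -> QA y -> QA (x * y) by apply: (rrelM QR).
have Qtw : QA (k *: (s * Rb - Ra * s)).
  rewrite twist; apply: (rrel_sum QR) => c cV; apply: QZ.
    by apply: QM; [apply: QVa|apply: QVb].
  by apply: QMA => //; apply: QAtransp.
have Qk : Q (k * (m b * g a - m a * g b)).
  rewrite mulrC [m b * _]mulrC [m a * _]mulrC; exact: Qmg.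
have [Qma Qmb] := (Qm aN, Qm bN); have [Qga Qgb] := (Qg aN, Qg bN).
by repeat (first [assumption | apply: (QD) | apply: (QN) | apply: (QMA)
  | apply: (QAscal) | apply: (QZ) | apply: (QM)]).
Qed.
End NoPole.

(** * Rational functions of one variable *)

Section RationalFunctions.
Context (K : fieldType).
Local Notation L := {fraction {poly K}}.
Local Notation "p %:F" := (tofrac p).
Implicit Types (f : L) (p q r s : {poly K}) (c k : K).

Definition ratC c : L := (c%:P)%:F.
Definition ratX : L := 'X%:F.

(** The value of a rational function at [c], as a relation: it relates [f] to
    nothing if [f] has a pole at [c]. *)
Definition val_at c f k : Prop :=
  exists r s, [/\ s.[c] != 0, f * s%:F = r%:F & k = r.[c] / s.[c]].

(** The value at infinity is the quotient of the coefficients of degree [d],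
    for any common bound [d] of the degrees that the denominator reaches. *)
Definition val_inf f k : Prop :=
  exists r s d, [/\ (size r <= d.+1)%N, (size s <= d.+1)%N, s`_d != 0,
    f * s%:F = r%:F & k = r`_d / s`_d].

Definition poles_in (cs : seq K) f : Prop :=
  exists j r, f * ((\prod_(c <- cs) ('X - c%:P)) ^+ j)%:F = r%:F.

Lemma val_at_ring_rel c : ring_rel (val_at c).
Proof.
split.
- by exists 1, 1; rewrite hornerC oner_eq0 mulr1 divr1.
- move=> f g k l [r [s [s0 fs ->]]] [r' [s' [s'0 gs ->]]].
  exists (r * s' - r' * s), (s * s'); split; first by rewrite hornerM mulf_neq0.
    by rewrite !(rmorphM, rmorphB) /= -fs -gs; ring.
  by rewrite hornerD hornerN !hornerM; field; rewrite s0 s'0.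
move=> f g k l [r [s [s0 fs ->]]] [r' [s' [s'0 gs ->]]].
exists (r * r'), (s * s'); split; first by rewrite hornerM mulf_neq0.
  by rewrite !rmorphM /= -fs -gs; ring.
  by rewrite !hornerM; field; rewrite s0 s'0.
Qed.

Lemma coef_top_mul r s d e : (size r <= d.+1)%N -> (size s <= e.+1)%N ->
  (r * s)`_(d + e) = r`_d * s`_e.
Proof.
move=> rd se; rewrite coefM (bigD1 (inord d)) //= big1 => [|i id].
  by rewrite inordK ?ltnS ?leq_addr // addKn addr0.
have {}id : (i != d :> nat).
  apply: contra id => /eqP eid; apply/eqP/val_inj.
  by rewrite /= inordK ?ltnS ?leq_addr.
have [ltid|ltdi|eid] := ltngtP i d; last by rewrite eid eqxx in id.
  rewrite [s`__]nth_default ?mulr0 //; apply: leq_trans se _.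
  by rewrite ltn_subRL ltn_add2r.
by rewrite nth_default ?mul0r //; apply: leq_trans rd _.
Qed.

Lemma size_top_mul r s d e : (size r <= d.+1)%N -> (size s <= e.+1)%N ->
  (size (r * s)%R <= (d + e).+1)%N.
Proof.
move=> rd se; apply: leq_trans (size_polyMleq _ _) _.
by rewrite -subn1 leq_subLR add1n -addSn -addnS leq_add.
Qed.

Lemma val_inf_ring_rel : ring_rel val_inf.
Proof.
split.
- exists 1, 1, 0%N; rewrite size_poly1 coefC /= oner_eq0 mulr1 divr1.
  by split.
- move=> f g k l [r [s [d [rd sd s0 fs ->]]]] [r' [s' [e [re se s'0 gs ->]]]].
  exists (r * s' - r' * s), (s * s'), (d + e)%N; split.
  + apply: leq_trans (size_polyD _ _) _; rewrite size_polyN geq_max.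
    by rewrite size_top_mul // addnC size_top_mul.
  + exact: size_top_mul.
  + by rewrite coef_top_mul // mulf_neq0.
  + by rewrite !(rmorphM, rmorphB) /= -fs -gs; ring.
  rewrite coefB.
  have -> : (r' * s)`_(d + e) = r'`_e * s`_d by rewrite addnC coef_top_mul.
  rewrite !coef_top_mul //.
  by field; rewrite s0 s'0.
move=> f g k l [r [s [d [rd sd s0 fs ->]]]] [r' [s' [e [re se s'0 gs ->]]]].
exists (r * r'), (s * s'), (d + e)%N; split.
+ exact: size_top_mul.
+ exact: size_top_mul.
+ by rewrite coef_top_mul // mulf_neq0.
+ by rewrite !rmorphM /= -fs -gs; ring.
by rewrite !coef_top_mul //; field; rewrite s0 s'0.
Qed.

Lemma poles_in_ring_rel cs : ring_rel (fun f (_ : L) => poles_in cs f).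
Proof.
split.
- by exists 0%N, 1; rewrite expr0 rmorph1 mulr1.
- move=> f g _ _ [j [r fr]] [i [s gs]].
  pose q := \prod_(c <- cs) ('X - c%:P).
  exists (j + i)%N, (r * q ^+ i - s * q ^+ j).
  by rewrite exprD !(rmorphM, rmorphB) /= -fr -gs -/q; ring.
move=> f g _ _ [j [r fr]] [i [s gs]].
exists (j + i)%N, (r * s).
by rewrite exprD !rmorphM /= -fr -gs; ring.
Qed.

Lemma reg_ring_rel c : ring_rel (fun f (_ : L) => exists k, val_at c f k).
Proof.
have V := val_at_ring_rel c.
split; first by exists 1; apply: rrel1 V.
  by move=> f g _ _ [k fk] [l gl]; exists (k - l); apply: (rrelB V).
by move=> f g _ _ [k fk] [l gl]; exists (k * l); apply: (rrelM V).
Qed.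

Lemma val_atC c k : val_at c (ratC k) k.
Proof. by exists k%:P, 1; rewrite !hornerC oner_eq0 divr1 mulr1. Qed.

Lemma val_atX c : val_at c ratX c.
Proof. by exists 'X, 1; rewrite hornerX hornerC oner_eq0 divr1 mulr1. Qed.

Lemma val_atV c f k : k != 0 -> val_at c f k -> val_at c f^-1 k^-1.
Proof.
move=> k0 [r [s [s0 fs ek]]]; subst k.
have r0 : r.[c] != 0 by apply: contraNneq k0 => ->; rewrite mul0r.
exists s, r; split; rewrite ?invf_div // -fs mulrA mulVf ?mul1r //.
apply: contraNneq r0 => f0; move: fs; rewrite f0 mul0r => /esym/eqP.
by rewrite tofrac_eq0 => /eqP ->; rewrite horner0.
Qed.

Lemma val_at0 c k : val_at c 0 k -> k = 0.
Proof.
move=> [r [s [s0 /esym/eqP]]]; rewrite mul0r tofrac_eq0 => /eqP -> ->.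
by rewrite horner0 mul0r.
Qed.

Lemma reg_divX f : val_at 0 f 0 -> exists k, val_at 0 (f / ratX) k.
Proof.
move=> [r [s [s0 fs /esym/eqP]]]; rewrite mulf_eq0 invr_eq0 (negPf s0) orbF.
move=> /factor_theorem[p]; rewrite subr0 => er.
exists (p.[0] / s.[0]), p, s; split=> //.
by rewrite mulrAC fs er rmorphM /= mulfK // tofrac_eq0 polyX_eq0.
Qed.

Lemma val_infC k : val_inf (ratC k) k.
Proof.
exists k%:P, 1, 0%N; rewrite size_poly1 size_polyC !coefC /= oner_eq0 divr1 mulr1.
by split=> //; case: (k != 0).
Qed.

Lemma ratX_subC_neq0 k : ratX - ratC k != 0.
Proof. by rewrite -rmorphB /= tofrac_eq0 polyXsubC_eq0. Qed.

Lemma val_inf_XsubV k : val_inf (ratX - ratC k)^-1 0.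
Proof.
exists 1, ('X - k%:P), 1%N; split; rewrite ?size_poly1 ?size_XsubC //.
- by rewrite coefB coefX coefC /= subr0 oner_eq0.
- by rewrite rmorphB /= mulVf ?ratX_subC_neq0 ?rmorph1.
by rewrite coefC mul0r.
Qed.

Lemma val_inf_Xsub_div k l : val_inf ((ratX - ratC k) / (ratX - ratC l)) 1.
Proof.
exists ('X - k%:P), ('X - l%:P), 1%N; split; rewrite ?size_XsubC //.
- by rewrite coefB coefX coefC /= subr0 oner_eq0.
- by rewrite !rmorphB /= divfK ?ratX_subC_neq0.
by rewrite !coefB !coefX !coefC /= !subr0 divr1.
Qed.

Lemma ratC_poles cs k : poles_in cs (ratC k).
Proof. by exists 0%N, k%:P; rewrite expr0 mulr1. Qed.

Lemma ratX_poles cs : poles_in cs ratX.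
Proof. by exists 0%N, 'X; rewrite expr0 mulr1. Qed.

Lemma XsubV_poles cs c : c \in cs -> poles_in cs (ratX - ratC c)^-1.
Proof.
move=> ccs; exists 1%N, (\prod_(b <- rem c cs) ('X - b%:P)).
rewrite expr1 (perm_big _ (perm_to_rem ccs)) big_cons rmorphM rmorphB /=.
by rewrite mulrA mulVf ?mul1r ?ratX_subC_neq0.
Qed.

Lemma dvd_prod_XsubC_exp (cs : seq K) j r : uniq cs ->
  (forall c, c \in cs -> ('X - c%:P) ^+ j %| r) ->
  (\prod_(c <- cs) ('X - c%:P)) ^+ j %| r.
Proof.
elim: cs => [|c cs IH] /=; first by rewrite big_nil expr1n dvd1p.
move=> /andP[ccs ucs] dv; rewrite big_cons exprMn Gauss_dvdp; last first.
  apply/coprimep_expl/coprimep_expr; rewrite coprimep_sym coprimep_XsubC.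
  by rewrite root_prod_XsubC.
rewrite dv ?mem_head // IH // => b bcs.
by rewrite dv // in_cons bcs orbT.
Qed.

(** The field of constants need not be algebraically closed, which is why the
    possible poles are listed in [cs]. *)
Lemma rat_liouville (cs : seq K) f : uniq cs -> poles_in cs f ->
  (forall c, c \in cs -> exists k, val_at c f k) -> val_inf f 0 -> f = 0.
Proof.
move=> ucs [j [r fr]] reg; set q := \prod_(c <- cs) _ in fr.
have q0 : q != 0 by apply/monic_neq0/monic_prod_XsubC.
have qj0 : (q ^+ j)%:F != 0 :> L by rewrite tofrac_eq0 expf_neq0.
have : q ^+ j %| r.
  apply: dvd_prod_XsubC_exp => // c ccs.
  have [k [r' [s [s0 fs _]]]] := reg c ccs.
  have e : r * s = r' * q ^+ j.
    by apply/eqP; rewrite -tofrac_eq !rmorphM /= -fr -fs mulrAC.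
  rewrite -(@Gauss_dvdpl _ r s); last first.
    by apply: coprimep_expl; rewrite coprimep_sym coprimep_XsubC.
  rewrite e; apply: dvdp_mull; apply: dvdp_exp2r.
  by rewrite /q (perm_big _ (perm_to_rem ccs)) big_cons dvdp_mulr.
move=> /dvdpP[p er].
have {fr} fp : f = p%:F.
  by apply: (mulIf qj0); rewrite fr er rmorphM.
move=> [r2 [s [d [rd sd s0 fs /esym/eqP]]]].
rewrite mulf_eq0 invr_eq0 (negPf s0) orbF => /eqP r20.
rewrite fp; have [->|p0] := eqVneq p 0; first exact: rmorph0.
have ps : p * s = r2 by apply/eqP; rewrite -tofrac_eq rmorphM /= -fp fs.
have sz : size s = d.+1.
  by apply/eqP; rewrite eqn_leq sd ltnNge; apply: contra s0 => sd'; rewrite nth_default.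
have sn0 : s != 0 by rewrite -size_poly_eq0 sz.
have r2n0 : r2 != 0 by rewrite -ps mulf_neq0.
have : (d < size r2)%N.
  by rewrite -ps size_mul // sz addnS /= -[d.+1]add1n leq_add2r lt0n size_poly_eq0.
move=> dr2; have szr : size r2 = d.+1 by apply/eqP; rewrite eqn_leq rd.
by move: r2n0; rewrite -lead_coef_eq0 lead_coefE szr /= r20 eqxx.
Qed.

End RationalFunctions.

(** * Specialization of Leibniz expansions *)

Lemma prod_zero_factor (R : pzRingType) (I : finType) (f : I -> R) i0 :
  f i0 = 0 -> \prod_i f i = 0.
Proof.
move=> f0; have : i0 \in index_enum I by apply: mem_index_enum.
elim: (index_enum I) => // i r IH; rewrite in_cons big_cons => /orP[/eqP <-|/IH ->].
  by rewrite f0 mul0r.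
by rewrite mulr0.
Qed.

Section KernelMatrix.
Context (K : comNzRingType) (n : nat).
Local Notation A := (galg K 'S_n).
Implicit Types (a i j : 'I_n) (N U : {set 'I_n}) (m g : 'I_n -> K) (y : 'I_n -> 'I_n -> K).

(** For [y i j = (z i - z j)^-1] this is the image of the Gaudin matrix.  The
    kernel [y] is arbitrary in order to let a point [a] go to infinity, which
    amounts to [y i a = 0]. *)
Definition kernel_ent N U m g y i j : A :=
  if i \in N then
    if i == j then (m i)%:A + g i *: \sum_(c in U :\ i) y i c *: transp K i c
    else if j \in U then (g i * y i j)%:A else 0
  else (i == j)%:R.

Definition kernel_minor N U m g y a j : A :=
  ncdet (fun i k => if i == a then (k == j)%:R else kernel_ent N U m g y i k).

Lemma kernel_minor_diag N U m g y a :
  kernel_minor N U m g y a a = ncdet (kernel_ent (N :\ a) U m g y).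
Proof.
apply: eq_ncdet => i k; rewrite /kernel_ent in_setD1.
by case: eqVneq => [->|] //=; rewrite eq_sym.
Qed.

Lemma kernel_drop N U m g y a :
  a \notin N -> (forall i, i \in N -> y i a = 0) ->
  ncdet (kernel_ent N U m g y) = ncdet (kernel_ent N (U :\ a) m g y).
Proof.
move=> aN ya; apply: eq_ncdet => i k; rewrite /kernel_ent; case: ifP => // iN.
case: ifP => _; last first.
  by rewrite in_setD1; case: eqVneq => [->|] //=; rewrite ya // mulr0 scale0r if_same.
congr (_ + _ *: _); rewrite (bigID (pred1 a)) /= addrC [X in _ + X]big1 ?addr0.
  by apply: eq_bigl => c; rewrite !inE -andbA; case: (c == a); rewrite ?andbF ?andbT.
by move=> c /andP[_ /eqP ->]; rewrite ya // scale0r.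
Qed.

Lemma kernel_minor_offdiag N U m g y a j : j != a ->
  (forall i, i \in N :\ a -> y i a = 0) -> kernel_minor N U m g y a j = 0.
Proof.
move=> ja ya; rewrite /kernel_minor /ncdet big1 // => s _.
rewrite (@prod_zero_factor _ _ _ (s^-1%g a)) ?mulr0 // permKV.
case: ifP => [_|/negbT ia]; first by rewrite eq_sym (negPf ja).
rewrite /kernel_ent (negPf ia); case: ifP => // iN.
by rewrite ya ?in_setD1 ?ia // mulr0 scale0r if_same.
Qed.

End KernelMatrix.

Section KernelRel.
Context (K K' : comNzRingType) (n : nat) (P : K -> K' -> Prop) (PP : ring_rel P).
Context (N U : {set 'I_n}) (m g : 'I_n -> K) (m' g' : 'I_n -> K').
Context (y : 'I_n -> 'I_n -> K) (y' : 'I_n -> 'I_n -> K').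

Lemma kernel_ent_rel i k :
  (i \in N -> P (m i) (m' i)) -> (i \in N -> P (g i) (g' i)) ->
  (forall c, i \in N -> c \in U -> i != c -> P (y i c) (y' i c)) ->
  galg_rel P (kernel_ent N U m g y i k) (kernel_ent N U m' g' y' i k).
Proof.
move=> Pm Pg Py; have QP := galg_ring_rel PP 'S_n.
rewrite /kernel_ent; case: ifP => iN; last exact: (rrel_nat QP).
case: eqVneq => ik.
  apply: (rrelD QP); first by apply: (galg_relA PP); apply: Pm.
  apply: (galg_relZ PP); first exact: Pg.
  apply: (rrel_sum QP) => c; rewrite in_setD1 => /andP[ci cU].
  apply: (galg_relZ PP); last exact: (galg_rel_base PP).
  by apply: Py => //; rewrite eq_sym.
case: ifP => kU; last exact: (rrel0 QP).
by apply: (galg_relA PP); apply: (rrelM PP); [apply: Pg | apply: Py].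
Qed.

Lemma kernel_minor_rel a j :
  (forall i, i \in N :\ a -> P (m i) (m' i)) ->
  (forall i, i \in N :\ a -> P (g i) (g' i)) ->
  (forall i c, i \in N :\ a -> c \in U -> i != c -> P (y i c) (y' i c)) ->
  galg_rel P (kernel_minor N U m g y a j) (kernel_minor N U m' g' y' a j).
Proof.
move=> Pm Pg Py; have QP := galg_ring_rel PP 'S_n.
apply: (ncdet_rel QP) => i k; case: eqVneq => ia; first exact: (rrel_nat QP).
apply: kernel_ent_rel => [iN|iN|c iN cU ic].
- by apply: Pm; rewrite in_setD1 ia.
- by apply: Pg; rewrite in_setD1 ia.
by apply: Py; rewrite // in_setD1 ia.
Qed.

End KernelRel.

Section CycsumRel.
Context (K K' : comNzRingType) (n : nat) (P : K -> K' -> Prop) (PP : ring_rel P).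
Implicit Types (U : {set 'I_n}).

Lemma cycsum_rel U v v' : P v v' -> galg_rel P (cycsum U v) (cycsum U v').
Proof.
move=> Pv; apply: (rrel_sum (galg_ring_rel PP _)) => s _.
apply: (galg_relZ PP); last exact: (galg_rel_base PP).
by apply: (rrelM PP); [apply: (rrel_sign PP) | apply: (rrelX PP)].
Qed.

Lemma wcycsum_coef_rel (D E : {set 'I_n}) al al' be be' :
  (forall i, i \in D -> P (al i) (al' i)) ->
  (forall i, i \in E -> P (be i) (be' i)) ->
  P ((\prod_(i in D) al i) * (\prod_(i in E) be i))
    ((\prod_(i in D) al' i) * (\prod_(i in E) be' i)).
Proof. by move=> Pal Pbe; apply: (rrelM PP); apply: (rrel_prod PP). Qed.

Context (U : {set 'I_n}) (al be : 'I_n -> K) (al' be' : 'I_n -> K') (v : K) (v' : K').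
Hypothesis Pal : forall i, i \in U -> P (al i) (al' i).
Hypothesis Pbe : forall i, i \in U -> P (be i) (be' i).
Hypothesis Pv : P v v'.

Let QP := galg_ring_rel PP 'S_n.

Let coefP (D : {set 'I_n}) : D \subset U ->
  P ((\prod_(i in D) al i) * (\prod_(i in U :\: D) be i))
    ((\prod_(i in D) al' i) * (\prod_(i in U :\: D) be' i)).
Proof.
move=> DU; apply: wcycsum_coef_rel => i.
  by move/(subsetP DU); apply: Pal.
by rewrite in_setD => /andP[_]; apply: Pbe.
Qed.

Lemma wcycsum_rel : galg_rel P (wcycsum U al be v) (wcycsum U al' be' v').
Proof.
apply: (rrel_sum QP) => D DU; apply: (galg_relZ PP); first exact: coefP.
by apply: (rrelM QP); apply: cycsum_rel => //; apply: (rrel1 PP).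
Qed.

Lemma wcycsum_al_rel a : galg_rel P (wcycsum_al a U al be v) (wcycsum_al a U al' be' v').
Proof.
apply: (rrel_sum QP) => D DU; apply: (galg_relZ PP); first exact: coefP.
by apply: (rrelM QP); apply: cycsum_rel => //; apply: (rrel1 PP).
Qed.

Lemma wcycsum_be_rel a : galg_rel P (wcycsum_be a U al be v) (wcycsum_be a U al' be' v').
Proof.
apply: (rrel_sum QP) => D DU; apply: (galg_relZ PP); first exact: coefP.
by apply: (rrelM QP); apply: cycsum_rel => //; apply: (rrel1 PP).
Qed.

End CycsumRel.

Section Det.
Context (F : fieldType) (n : nat).
Local Notation A := (galg F 'S_n).
Implicit Types (a b i j : 'I_n) (N U : {set 'I_n}) (z m g : 'I_n -> F).

Definition cauchy z i j : F := (z i - z j)^-1.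

Definition detval N U m g z : A := ncdet (kernel_ent N U m g (cauchy z)).

Lemma gaudin_kernel_ent N U m g z :
  gaudin_ent N U m g z (kz N U z) =2 kernel_ent N U m g (cauchy z).
Proof.
by move=> i j; rewrite /gaudin_ent /kernel_ent /kz /kz_on; case: ifP => // ->.
Qed.

Definition separated N U z :=
  forall a b, a \in N -> b \in U -> a != b -> z a != z b.

Lemma detvalE N U m g z : N \subset U -> separated N U z ->
  ev (kz N U z) (\det (gaudin_mx N U m g z)) = detval N U m g z.
Proof.
move=> NU zI; have hC := kz_comm NU zI.
rewrite (ev_det hC); apply: eq_ncdet => i j.
by rewrite (ev_gaudin_ent N U m g z i j hC) gaudin_kernel_ent.
Qed.

(** Expansion along the row [a].  The columns outside [N] do not contribute:
    the corresponding minor has two equal rows. *)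
Lemma detval_expand N U m g z a : N \subset U -> separated N U z -> a \in N ->
  detval N U m g z
  = ((m a)%:A + g a *: kz_on (U :\ a) z a)
      * kernel_minor N U m g (cauchy z) a a
    + \sum_(j in N :\ a) (g a * cauchy z a j)
        *: kernel_minor N U m g (cauchy z) a j.
Proof.
move=> NU zI aN; have hC := kz_comm NU zI.
rewrite -detvalE // (det_expand_unit_rows _ a) ev_sum.
pose h := kz N U z.
have ev_minor j : ev h (\det (repl_row (gaudin_mx N U m g z) a (unit_row _ j)))
    = kernel_minor N U m g (cauchy z) a j.
  rewrite (ev_det hC); apply: eq_ncdet => i k.
  rewrite mxE; case: eqVneq => _; first by rewrite /unit_row; case: eqP; rewrite ?ev1 ?ev0.
  by rewrite (ev_gaudin_ent N U m g z i k hC) gaudin_kernel_ent.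
rewrite (bigD1 a) //=; congr (_ + _).
  rewrite (evM hC) ev_minor (ev_gaudin_ent N U m g z a a hC).
  by rewrite /gaudin_ent aN eqxx /kz aN.
rewrite (bigID (mem (N :\ a))) /= [X in _ + X]big1 ?addr0; last first.
  move=> j /andP[ja]; rewrite in_setD1 ja /= => jN.
  have -> : \det (repl_row (gaudin_mx N U m g z) a (unit_row _ j)) = 0.
    apply: (determinant_alternate ja) => k.
    by rewrite !mxE (negPf ja) eqxx (negPf jN) /unit_row eq_sym.
  by rewrite mulr0 ev0.
apply: eq_big => [j|j /andP[ja]]; first by rewrite in_setD1; case: (j == a).
rewrite in_setD1 ja /= => jN.
rewrite (evM hC) ev_minor (ev_gaudin_ent N U m g z a j hC).
by rewrite /gaudin_ent aN eq_sym (negPf ja) (subsetP NU) // mulr_algl.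
Qed.

End Det.

(** * The determinant as a weighted cycle sum *)

Section Weights.
Context (F : fieldType) (n : nat) (u v : F) (z : 'I_n -> F).
Definition wal i : F := u - z i.
Definition wbe i : F := - z i.
Definition wm i : F := v * wal i + wbe i.
Definition wg i : F := wal i * wbe i.

(** The factor in front of the determinant is [wcycsum] of the points outside
    [N] alone, which are meant to be all at 0: there [be] vanishes. *)
Definition det_identity (N U : {set 'I_n}) : Prop :=
  u ^+ #|U :\: N| *: (cycsum (U :\: N) v * detval N U wm wg z)
  = wcycsum U wal wbe v.
End Weights.

Section FieldIdentities.
Context (F : fieldType).
Implicit Types (x u v : F).

Lemma scaler_lincomb (V : lmodType F) x p q (X Y : V) :
  x *: (p *: X + q *: Y) = (x * p) *: X + (x * q) *: Y.
Proof. by rewrite scalerDr !scalerA. Qed.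

Lemma lead_wal x u : x != 0 -> x^-1 * (u - x) = u * x^-1 - 1.
Proof. by move=> x0; field. Qed.

Lemma lead_wm x u v : x != 0 ->
  x^-1 * (v * (u - x) + - x) = v * u * x^-1 - (v + 1).
Proof. by move=> x0; field. Qed.

(** That this quotient has no pole is what [gaudin_no_pole] asks of the diagonal
    weights [wm] and of the off-diagonal weights [wg]. *)
Lemma weights_divided_difference n u v (z : 'I_n -> F) a b : z a != z b ->
  (wg u z a * wm u v z b - wg u z b * wm u v z a) / (z a - z b)
  = - (v * (wal u z a * wal u z b) + wbe z a * wbe z b).
Proof. by move=> ab; rewrite /wg /wm /wal /wbe; field; rewrite subr_eq0. Qed.
End FieldIdentities.

Section RatConstants.
Context (K : fieldType).
Implicit Types c k : K.

Lemma ratCB c k : ratC (c - k) = ratC c - ratC k.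
Proof. by rewrite /ratC polyCB rmorphB. Qed.

Lemma ratC0 : ratC (0 : K) = 0. Proof. exact: rmorph0. Qed.

Lemma ratCV c : ratC c^-1 = (ratC c)^-1.
Proof.
have [->|c0] := eqVneq c 0; first by rewrite invr0 ratC0 invr0.
have e : ratC c * ratC c^-1 = 1 by rewrite /ratC -rmorphM -polyCM mulfV.
have rc0 : ratC c != 0.
  by apply: contraNneq (oner_neq0 {fraction {poly K}}) => c00; rewrite -e c00 mul0r.
by apply: (mulfI rc0); rewrite e mulfV.
Qed.

Lemma ratC_inj : injective (@ratC K).
Proof. by move=> c k /eqP; rewrite tofrac_eq => /eqP /polyC_inj. Qed.

Lemma ratX_neqC c : ratX K != ratC c.
Proof. by rewrite -subr_eq0 ratX_subC_neq0. Qed.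
End RatConstants.

Section Step.
Context (K : fieldType) (n : nat) (u v : K) (z : 'I_n -> K).
Context (N U : {set 'I_n}) (a : 'I_n).
Local Notation L := {fraction {poly K}}.
Hypotheses (NU : N \subset U) (aN : a \in N).
Hypothesis zT : forall t, t \in U :\: N -> z t = 0.
Hypothesis zI : separated N U z.
Hypothesis zn0 : forall b, b \in N :\ a -> z b != 0.

Let T := U :\: N.
Let z0 i := if i == a then 0 else z i.
Let zx i : L := if i == a then ratX K else ratC (z i).
Let uL : L := ratC u.
Let vL : L := ratC v.
Let D := detval N U (wm uL vL zx) (wg uL zx) zx.
Let W := wcycsum U (wal uL zx) (wbe zx) vL.
Let G := uL ^+ #|T| *: (cycsum T vL * D) - W.

Let aU : a \in U := subsetP NU a aN.

Let zxC i : i != a -> zx i = ratC (z i).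
Proof. by rewrite /zx => /negPf ->. Qed.

Let zxa : zx a = ratX K. Proof. by rewrite /zx eqxx. Qed.

Let zxI : separated N U zx.
Proof.
move=> i j iN jU ij; rewrite /zx.
case: (eqVneq i a) => ia; case: (eqVneq j a) => ja.
- by move: ij; rewrite ia ja eqxx.
- exact: ratX_neqC.
- by rewrite eq_sym ratX_neqC.
by rewrite (inj_eq (@ratC_inj K)) zI.
Qed.

Let aT : a \notin T. Proof. by rewrite /T in_setD aN. Qed.

Let ratC_mw (P : L -> K -> Prop) (z' : 'I_n -> K) i : ring_rel P ->
  (forall k, P (ratC k) k) -> P (zx i) (z' i) ->
  [/\ P (wm uL vL zx i) (wm u v z' i), P (wg uL zx i) (wg u z' i),
      P (wal uL zx i) (wal u z' i) & P (wbe zx i) (wbe z' i)].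
Proof.
move=> PP PC Pz.
have Pu : P uL u := PC u.
have Pv : P vL v := PC v.
have Pal : P (wal uL zx i) (wal u z' i) by apply: (rrelB PP).
have Pbe : P (wbe zx i) (wbe z' i) by apply: (rrelN PP).
split=> //; last by apply: (rrelM PP).
by apply: (rrelD PP) => //; apply: (rrelM PP).
Qed.

Let val_cauchy c (z' : 'I_n -> K) i j :
  val_at c (zx i) (z' i) -> val_at c (zx j) (z' j) -> z' i != z' j ->
  val_at c (cauchy zx i j) (cauchy z' i j).
Proof.
move=> vi vj zij; apply: val_atV; first by rewrite subr_eq0.
exact: (rrelB (val_at_ring_rel c)).
Qed.

Let val_z0 i : val_at 0 (zx i) (z0 i).
Proof. by rewrite /zx /z0; case: ifP => _; [apply: val_atX | apply: val_atC]. Qed.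

Let N' := N :\ a.

Let z0_sep i j : i \in N' -> j \in U -> i != j -> z0 i != z0 j.
Proof.
rewrite /N' in_setD1 /z0 => /andP[ia iN] jU ij; rewrite (negPf ia).
case: (eqVneq j a) => ja; last exact: zI.
by apply: zn0; rewrite in_setD1 ia.
Qed.

(** The factor [- x] of [wg] kills the row [a] at [x = 0], except for the terms
    of [H a] that come from points already at 0. *)
Let G_at_0 : det_identity u v z0 N' U -> galg_rel (val_at 0) G 0.
Proof.
move=> IH; have V := val_at_ring_rel (0 : K); have VA := galg_ring_rel V 'S_n.
have mw i := ratC_mw V (@val_atC K 0) (val_z0 i).
have minor j := kernel_minor_rel V (N := N) (U := U) (a := a) j
  (fun i _ => let: And4 p _ _ _ := mw i in p)
  (fun i _ => let: And4 _ p _ _ := mw i in p)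
  (fun i c iN cU ic => val_cauchy (val_z0 i) (val_z0 c) (z0_sep iN cU ic)).
have TU : U :\: N' = a |: T.
  apply/setP=> i; rewrite !inE negb_and negbK.
  by case: eqVneq => [->|] //=; rewrite aU.
have z0a : z0 a = 0 by rewrite /z0 eqxx.
have [ma ga _ _] := mw a.
have ga0 : wg u z0 a = 0 by rewrite /wg /wbe z0a oppr0 mulr0.
have Rcol : galg_rel (val_at 0)
    ((wm uL vL zx a)%:A + wg uL zx a *: kz_on (U :\ a) zx a)
    ((u * v)%:A - u *: jm K a T).
  apply: (rrelD VA).
    apply: (galg_relA V); apply: (eq_rrel ma) => //.
    by rewrite /wm /wal /wbe z0a oppr0 !addr0 mulrC.
  have -> : - (u *: jm K a T)
      = \sum_(c in U :\ a) (if c \in T then - u else 0) *: transp K a c.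
    rewrite (bigID (mem T)) /= [X in _ + X]big1 ?addr0; last first.
      by move=> c /andP[_ /negPf ->]; rewrite scale0r.
    rewrite scaler_sumr -sumrN; apply: eq_big => [c|c cT].
      rewrite !inE; case: eqVneq => [->|] //=; first by rewrite aN.
      by move=> _; rewrite andbC; case: (c \in U); rewrite ?andbT //= andbF.
    by rewrite cT scaleNr.
  rewrite /kz_on scaler_sumr; apply: (rrel_sum VA) => c.
  rewrite in_setD1 => /andP[ca cU]; rewrite scalerA.
  apply: (galg_relZ V); last exact: (galg_rel_base V).
  have ac : a != c by rewrite eq_sym.
  case: ifP => cT.
    have -> : wg uL zx a * (zx a - zx c)^-1 = - (uL - zx a).
      rewrite (zxC ca) (zT cT) ratC0 subr0 /wg /wal /wbe zxa mulrN mulNr mulfK //.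
      by rewrite -[ratX K]subr0 -(ratC0 K) ratX_subC_neq0.
    apply: (eq_rrel (rrelN V (rrelB V (val_atC 0 u) (val_z0 a)))) => //.
    by rewrite z0a subr0.
  have cN' : c \in N'.
    by move: cT; rewrite /N' in_setD1 ca in_setD cU andbT => /negbFE.
  have czn : z0 a != z0 c by rewrite z0a /z0 (negPf ca) eq_sym zn0.
  apply: (eq_rrel (rrelM V ga (val_cauchy (val_z0 a) (val_z0 c) czn))) => //.
  by rewrite ga0 mul0r.
have Rsum : galg_rel (val_at 0)
    (\sum_(j in N') (wg uL zx a * cauchy zx a j)
        *: kernel_minor N U (wm uL vL zx) (wg uL zx) (cauchy zx) a j) 0.
  have -> : 0 = \sum_(j in N') (wg u z0 a * cauchy z0 a j)
        *: kernel_minor N U (wm u v z0) (wg u z0) (cauchy z0) a j :> galg K 'S_n.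
    by rewrite big1 // => j _; rewrite ga0 mul0r scale0r.
  apply: (rrel_sum VA) => j jN'; apply: (galg_relZ V); last exact: minor.
  apply: (rrelM V) => //; apply: val_cauchy => //.
  by rewrite z0a /z0; move: (jN'); rewrite in_setD1 => /andP[/negPf -> _]; rewrite eq_sym zn0.
have RD := rrelD VA (rrelM VA Rcol (minor a)) Rsum.
rewrite -detval_expand // addr0 kernel_minor_diag -/N' in RD.
have RW : galg_rel (val_at 0) W (wcycsum U (wal u z0) (wbe z0) v).
  apply: (wcycsum_rel V) => [i _|i _|]; last exact: val_atC.
  - by have [] := mw i.
  - by have [] := mw i.
have RC := cycsum_rel V T (val_atC 0 v).
have RG := rrelB VA (galg_relZ V (rrelX V #|T| (val_atC 0 u)) (rrelM VA RC RD)) RW.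
apply: (eq_rrel RG) => //.
move: IH; rewrite /det_identity TU cardsU1 aT exprS cycsum_recr // => <-.
apply/eqP; rewrite subr_eq0; apply/eqP.
rewrite [u * u ^+ _]mulrC -[RHS]scalerA; congr (_ *: _).
have -> : (u * v)%:A - u *: jm K a T = u *: (v%:A - jm K a T).
  by rewrite scalerBr scalerA.
by rewrite -scalerAl -scalerAr mulrA.
Qed.

Let ratX_neq0 : ratX K != 0.
Proof. by rewrite -(ratC0 K) ratX_neqC. Qed.

Let inf_Xinv : val_inf (ratX K)^-1 0.
Proof. by have := val_inf_XsubV (0 : K); rewrite ratC0 subr0. Qed.

Let y' i c := if c == a then 0 else cauchy z i c.

Let minor_drop : kernel_minor N U (wm u v z) (wg u z) y' a a
  = detval N' (U :\ a) (wm u v z) (wg u z) z.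
Proof.
rewrite kernel_minor_diag (@kernel_drop _ _ _ _ _ _ _ a) ?setD11 //; last first.
  by move=> i _; rewrite /y' eqxx.
apply: eq_ncdet => i k; rewrite /kernel_ent -/N'; case: ifP => // iN.
case: ifP => _.
  congr (_ + _ *: _); apply: eq_bigr => c; rewrite !inE => /and3P[_ ca _].
  by rewrite /y' (negPf ca).
by case: ifP => //; rewrite in_setD1 /y' => /andP[/negPf -> _].
Qed.

(** On the row [a] the off-diagonal entries grow like [x] too, but the column [a]
    of every other row tends to 0, so only the diagonal entry contributes. *)
Let G_at_inf : det_identity u v z N' (U :\ a) ->
  galg_rel (@val_inf K) ((ratX K)^-1 *: G) 0.
Proof.
move=> IH; have V := @val_inf_ring_rel K; have VA := galg_ring_rel V 'S_n.
have val_z i : i != a -> val_inf (zx i) (z i).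
  by move=> ia; rewrite zxC //; apply: val_infC.
have mw i ia := ratC_mw V (@val_infC K) (val_z i ia).
have minor j := kernel_minor_rel V (N := N) (U := U) (a := a)
  (y := cauchy zx) (y' := y') j
  (fun i iN => let: And4 p _ _ _ := mw i (proj1 (setD1P iN)) in p)
  (fun i iN => let: And4 _ p _ _ := mw i (proj1 (setD1P iN)) in p).
have {}minor j : galg_rel (@val_inf K)
    (kernel_minor N U (wm uL vL zx) (wg uL zx) (cauchy zx) a j)
    (kernel_minor N U (wm u v z) (wg u z) y' a j).
  apply: minor => i c; rewrite in_setD1 => /andP[ia iN] cU ic.
  rewrite /y' /cauchy zxC //; case: ifP => [/eqP ->|/negbT ca].
    rewrite zxa -opprB invrN -oppr0; apply: (rrelN V); exact: val_inf_XsubV.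
  by rewrite zxC // -ratCB -ratCV; apply: val_infC.
have coefa c : c \in U :\ a ->
    val_inf ((ratX K)^-1 * (wg uL zx a * (zx a - zx c)^-1)) 1.
  rewrite in_setD1 => /andP[ca cU]; rewrite (zxC ca) /wg /wal /wbe zxa.
  have -> : (ratX K)^-1 * ((uL - ratX K) * - ratX K * (ratX K - ratC (z c))^-1)
      = (ratX K - uL) / (ratX K - ratC (z c)).
    by rewrite mulrN mulNr mulrN [_ * ratX K]mulrC -mulrA mulKf // -mulNr opprB.
  exact: val_inf_Xsub_div.
have Rcol : galg_rel (@val_inf K)
    ((ratX K)^-1 *: ((wm uL vL zx a)%:A + wg uL zx a *: kz_on (U :\ a) zx a))
    (- (v + 1)%:A + jm K a (U :\ a)).
  rewrite scalerDr; apply: (rrelD VA).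
    rewrite scalerA -scaleNr; apply: (galg_relA V).
    have -> : (ratX K)^-1 * wm uL vL zx a = vL * uL * (ratX K)^-1 - (vL + 1).
      by rewrite /wm /wal /wbe zxa; apply: lead_wm.
    rewrite -[- (v + 1)]add0r -(mulr0 (v * u)).
    apply: (rrelB V).
      apply: (rrelM V) => //; apply: (rrelM V); exact: val_infC.
    by apply: (rrelD V); [apply: val_infC | apply: (rrel1 V)].
  rewrite /kz_on !scaler_sumr /jm; apply: (rrel_sum VA) => c cU.
  rewrite !scalerA -[transp K a c]scale1r -mulrA.
  by apply: (galg_relZ V); [apply: coefa | apply: (galg_rel_base V)].
have Rsum : galg_rel (@val_inf K)
    ((ratX K)^-1 *: \sum_(j in N') (wg uL zx a * cauchy zx a j)
        *: kernel_minor N U (wm uL vL zx) (wg uL zx) (cauchy zx) a j) 0.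
  have -> : 0 = \sum_(j in N') 1 *: kernel_minor N U (wm u v z) (wg u z) y' a j
      :> galg K 'S_n.
    rewrite big1 // => j; rewrite in_setD1 => /andP[ja _].
    rewrite kernel_minor_offdiag ?scaler0 // => i _.
    by rewrite /y' eqxx.
  rewrite scaler_sumr; apply: (rrel_sum VA) => j jN'; rewrite scalerA.
  apply: (galg_relZ V); last exact: minor.
  apply: coefa; move: jN'; rewrite !in_setD1 => /andP[-> /=].
  exact: (subsetP NU).
have RD := rrelD VA (rrelM VA Rcol (minor a)) Rsum.
rewrite -scalerAl -scalerDr -detval_expand // addr0 minor_drop in RD.
have RC := cycsum_rel V T (val_infC v).
have UE : U = a |: (U :\ a) by rewrite setD1K.
have RW : galg_rel (@val_inf K) ((ratX K)^-1 *: W)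
    (- (((v + 1)%:A - jm K a (U :\ a)) * wcycsum (U :\ a) (wal u z) (wbe z) v)).
  have aU' : a \notin U :\ a by rewrite setD11.
  rewrite -(wcycsum_lead _ _ _ aU') opprD.
  have -> : W = wal uL zx a *: wcycsum_al a (U :\ a) (wal uL zx) (wbe zx) vL
              + wbe zx a *: wcycsum_be a (U :\ a) (wal uL zx) (wbe zx) vL.
    by rewrite -(wcycsum_setU1 _ _ _ aU') -UE.
  rewrite scaler_lincomb.
  have mal i : i \in U :\ a -> val_inf (wal uL zx i) (wal u z i).
    by rewrite in_setD1 => /andP[ia _]; have [] := mw i ia.
  have mbe i : i \in U :\ a -> val_inf (wbe zx i) (wbe z i).
    by rewrite in_setD1 => /andP[ia _]; have [] := mw i ia.
  apply: (rrelD VA); rewrite -scaleN1r; apply: (galg_relZ V).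
  - have -> : (ratX K)^-1 * wal uL zx a = uL * (ratX K)^-1 - 1.
      by rewrite /wal zxa; apply: lead_wal.
    apply: (eq_rrel (rrelB V (rrelM V (val_infC u) inf_Xinv) (rrel1 V))) => //.
    by rewrite mulr0 sub0r.
  - by apply: (wcycsum_al_rel V) => //; apply: val_infC.
  - rewrite /wbe zxa mulrN mulVf //; apply: (rrelN V); exact: (rrel1 V).
  - by apply: (wcycsum_be_rel V) => //; apply: val_infC.
have RG := rrelB VA (galg_relZ V (rrelX V #|T| (val_infC u)) (rrelM VA RC RD)) RW.
apply: (eq_rrel RG).
  by rewrite /G scalerBr -scalerAr !scalerA [_ * (ratX K)^-1]mulrC.
have UN : (U :\ a) :\: N' = T.
  by apply/setP=> i; rewrite !inE; case: eqVneq => [->|] //=; rewrite aN.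
move: IH; rewrite /det_identity UN => <-; apply/eqP.
have -> : - (v + 1)%:A + jm K a (U :\ a) = - ((v + 1)%:A - jm K a (U :\ a)).
  by rewrite opprB addrC.
rewrite opprK mulNr mulrN scalerN addrC subr_eq0 -scalerAr.
apply/eqP; congr (_ *: _); rewrite !mulrA; congr (_ * _).
rewrite mulrBl mulrBr -scalerAl -scalerAr mul1r mulr1; congr (_ - _).
apply: comm_jm_cycsum_sub => //.
by apply/subsetP=> t tT; rewrite in_setD1 (subsetP (subsetDl U N)) // andbT;
  apply: contraNneq aT => <-.
Qed.

Let G_pred (Q : L -> Prop) : ring_rel (fun f (_ : L) => Q f) ->
  (forall k, Q (ratC k)) -> Q (ratX K) -> (forall h, Q (D h)) ->
  forall h, Q (G h).
Proof.
move=> QQ QC QX QD; have QA := galg_ring_rel QQ 'S_n.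
have Qz i : Q (zx i) by rewrite /zx; case: ifP.
have RC := @cycsum_rel _ _ n _ QQ T vL vL (QC v).
have Qal i : Q (wal uL zx i) by apply: (rrelB QQ (x' := 0) (y' := 0)); [apply: QC|].
have Qbe i : Q (wbe zx i) by apply: (rrelN QQ (x' := 0)).
have RW := @wcycsum_rel _ _ n _ QQ U (wal uL zx) (wbe zx) (wal uL zx) (wbe zx)
  vL vL (fun i _ => Qal i) (fun i _ => Qbe i) (QC v).
have RD : galg_rel (fun f (_ : L) => Q f) D D by [].
have RG := rrelB QA (galg_relZ QQ (rrelX QQ #|T| (x := uL) (x' := uL) (QC u))
  (rrelM QA RC RD)) RW.
exact: RG.
Qed.

Let cs := undup (0 :: [seq z b | b <- enum N']).

Let G_poles h : poles_in cs (G h).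
Proof.
have V := poles_in_ring_rel cs.
have inv_X c : c \in U -> c != a -> poles_in cs (ratX K - zx c)^-1.
  move=> cU ca; rewrite zxC //; apply: XsubV_poles; rewrite mem_undup in_cons.
  have [cN|cN] := boolP (c \in N); last by rewrite zT ?eqxx // in_setD cN.
  by rewrite map_f ?orbT // mem_enum in_setD1 ca.
apply: (G_pred V (ratC_poles cs) (ratX_poles cs)).
have VA := galg_ring_rel V 'S_n.
have Qz i : poles_in cs (zx i).
  by rewrite /zx; case: ifP => _; [apply: ratX_poles | apply: ratC_poles].
have Qal i : poles_in cs (wal uL zx i).
  by apply: (rrelB V (x' := 0) (y' := 0)) => //; apply: ratC_poles.
have Qbe i : poles_in cs (wbe zx i) by apply: (rrelN V (x' := 0)).
apply: (ncdet_rel VA (M' := kernel_ent N U (wm uL vL zx) (wg uL zx) (cauchy zx))).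
move=> i k; apply: (kernel_ent_rel V) => [_|_|c iN cU ic].
- apply: (rrelD V (x' := 0) (y' := 0)) => //.
  by apply: (rrelM V (x' := 0) (y' := 0)) => //; apply: ratC_poles.
- exact: (rrelM V (x' := 0) (y' := 0)).
rewrite /cauchy; have [ia|ia] := eqVneq i a.
  by rewrite ia zxa; apply: inv_X => //; rewrite -ia eq_sym.
have [ca|ca] := eqVneq c a.
  rewrite ca zxa -opprB invrN; apply: (rrelN V (x' := 0)).
  by apply: inv_X => //; apply: (subsetP NU).
by rewrite !zxC // -ratCB -ratCV; apply: ratC_poles.
Qed.

Let G_reg b h : b \in N' -> exists k, val_at (z b) (G h) k.
Proof.
move=> bN'; have := bN'; rewrite in_setD1 => /andP[ba bN].
have V := reg_ring_rel (z b); have VV := val_at_ring_rel (z b).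
have regC k : exists k', val_at (z b) (ratC k) k' by exists k; apply: val_atC.
have regX : exists k', val_at (z b) (ratX K) k' by exists (z b); apply: val_atX.
move: h; apply: (G_pred V regC regX).
have Qz i : exists k, val_at (z b) (zx i) k.
  by rewrite /zx; case: ifP => _; [apply: regX | apply: regC].
have Qal i : exists k, val_at (z b) (wal uL zx i) k.
  by apply: (rrelB V (x' := 0) (y' := 0)) => //; apply: regC.
have Qbe i : exists k, val_at (z b) (wbe zx i) k by apply: (rrelN V (x' := 0)).
have inv_X c : c \in U -> c != a -> c != b ->
    exists k, val_at (z b) (ratX K - zx c)^-1 k.
  move=> cU ca cb; exists (z b - z c)^-1; rewrite zxC //.
  apply: val_atV; first by rewrite subr_eq0 zI // eq_sym.
  by apply: (rrelB VV); [apply: val_atX | apply: val_atC].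
move=> h; rewrite /D -detvalE //.
have ab : a != b by rewrite eq_sym.
have := gaudin_no_pole (Q := fun f => exists k, val_at (z b) f k) V
  (m := wm uL vL zx) (g := wg uL zx) NU zxI aN bN ab.
apply.
- move=> i _; apply: (rrelD V (x' := 0) (y' := 0)) => //.
  by apply: (rrelM V (x' := 0) (y' := 0)) => //; apply: regC.
- by move=> i _; apply: (rrelM V (x' := 0) (y' := 0)).
- by apply: (rrelB V (x' := 0) (y' := 0)).
- have -> : (wg uL zx a * wm uL vL zx b - wg uL zx b * wm uL vL zx a) / (zx a - zx b)
      = - (vL * (wal uL zx a * wal uL zx b) + wbe zx a * wbe zx b).
    by apply: weights_divided_difference; apply: zxI => //; apply: (subsetP NU).
  apply: (rrelN V (x' := 0)); apply: (rrelD V (x' := 0) (y' := 0)).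
    apply: (rrelM V (x' := 0) (y' := 0)); first exact: regC.
    exact: (rrelM V (x' := 0) (y' := 0)).
  exact: (rrelM V (x' := 0) (y' := 0)).
move=> i j iN jU ij; have [ia|ia] := eqVneq i a => /=.
  move=> jb _; rewrite ia zxa; apply: inv_X => //.
  by rewrite -ia eq_sym.
move=> _; have [ja|ja] := eqVneq j a => /=.
  rewrite andbT => ib; rewrite ja zxa -opprB invrN.
  by apply: (rrelN V (x' := 0)); apply: inv_X => //; apply: (subsetP NU).
by move=> _; rewrite !zxC // -ratCB -ratCV; apply: regC.
Qed.

Lemma det_identity_step : det_identity u v z0 N' U ->
  det_identity u v z N' (U :\ a) -> det_identity u v z N U.
Proof.
move=> IH0 IHinf.
have G0 h : G h = 0.
  have f0 : G h / ratX K = 0.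
    apply: (@rat_liouville _ cs); first exact: undup_uniq.
    - have VP := poles_in_ring_rel cs.
      apply: (rrelM VP (x' := 0) (y' := 0)); first exact: G_poles.
      rewrite -[ratX K]subr0 -(ratC0 K); apply: XsubV_poles.
      by rewrite mem_undup mem_head.
    - move=> c; rewrite mem_undup in_cons => /orP[/eqP ->|/mapP[b]].
        by apply: reg_divX; have := G_at_0 IH0 h; rewrite [X in val_at _ _ X]ffunE.
      rewrite mem_enum => bN' ->; have V := reg_ring_rel (z b).
      apply: (rrelM V (x' := 0) (y' := 0)); first exact: G_reg.
      by exists (z b)^-1; apply: val_atV (val_atX _); apply: zn0.
    have := G_at_inf IHinf h; rewrite ffunE [X in val_inf _ X]ffunE.
    by rewrite mulrC.
  by move/eqP: f0; rewrite mulf_eq0 invr_eq0 (negPf ratX_neq0) orbF => /eqP.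
have V := val_at_ring_rel (z a); have VA := galg_ring_rel V 'S_n.
have val_z i : val_at (z a) (zx i) (z i).
  by rewrite /zx; case: eqVneq => [->|_]; [apply: val_atX | apply: val_atC].
have mw i := ratC_mw V (@val_atC K (z a)) (val_z i).
have RD : galg_rel (val_at (z a)) D (detval N U (wm u v z) (wg u z) z).
  apply: (ncdet_rel VA) => i k.
  apply: (kernel_ent_rel V) => [_|_|c iN cU ic].
  - by have [] := mw i.
  - by have [] := mw i.
  by apply: val_cauchy => //; apply: zI.
have RW : galg_rel (val_at (z a)) W (wcycsum U (wal u z) (wbe z) v).
  apply: (wcycsum_rel V) => [i _|i _|]; last exact: val_atC.
  - by have [] := mw i.
  - by have [] := mw i.
have RC := cycsum_rel V T (val_atC (z a) v).
have RG := rrelB VA (galg_relZ V (rrelX V #|T| (val_atC (z a) u)) (rrelM VA RC RD)) RW.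
apply/eqP; rewrite /det_identity -subr_eq0; apply/eqP/ffunP=> h.
rewrite [RHS]ffunE; apply: (@val_at0 _ (z a)).
by rewrite -(G0 h); apply: RG.
Qed.

End Step.

Lemma wcycsum_be0 (F : comNzRingType) n (U : {set 'I_n}) (al be : 'I_n -> F) v c :
  {in U, forall i, al i = c} -> {in U, forall i, be i = 0} ->
  wcycsum U al be v = c ^+ #|U| *: cycsum U v.
Proof.
move=> alc be0; rewrite /wcycsum (bigD1 U) //= [X in _ + X]big1 ?addr0; last first.
  move=> D /andP[DU DnU]; have /subsetPn[i iU iD] : ~~ (U \subset D).
    by apply: contra DnU => UD; rewrite eqEsubset DU.
  rewrite [\prod_(j in U :\: D) _](bigD1 i) ?in_setD ?iU ?iD //=.
  by rewrite be0 // mul0r mulr0 scale0r.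
rewrite setDv big_set0 mulr1 cycsum0 mulr1; congr (_ *: _).
by rewrite (eq_bigr (fun=> c)) ?prodr_const.
Qed.

(** The point moved to 0 must not collide with another point of [N], so a
    point that already is at 0 has to be chosen first. *)
Theorem gaudin_det_identity (F : fieldType) (n : nat) (u v : F) (z : 'I_n -> F)
    (N U : {set 'I_n}) : N \subset U -> separated N U z ->
  (forall t, t \in U :\: N -> z t = 0) -> det_identity u v z N U.
Proof.
have [k] := ubnP #|N|; elim: k => // k IH in N U z *.
rewrite ltnS => Nk NU zI zT; have [N0|[a0 a0N]] := set_0Vmem N.
  rewrite /det_identity N0 setD0 (wcycsum_be0 v (c := u)); first last.
  - by move=> i iU; rewrite /wbe zT ?oppr0 // N0 setD0.
  - by move=> i iU; rewrite /wal zT ?subr0 // N0 setD0.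
  congr (_ *: _); rewrite -[RHS]mulr1; congr (_ * _).
  rewrite /detval /ncdet (bigD1 1%g) //= [X in _ + X]big1 ?addr0 => [|s s1].
    rewrite odd_perm1 mul1r big1 // => i _.
    by rewrite /kernel_ent in_set0 perm1 eqxx.
  have /existsP[i si] : [exists i, s i != i].
    rewrite -negb_forall; apply: contra s1 => /forallP s1.
    by apply/eqP/permP=> i; rewrite perm1; apply/eqP.
  rewrite (@prod_zero_factor _ _ _ i) ?mulr0 //.
  by rewrite /kernel_ent in_set0 eq_sym (negPf si).
have [a aN zn0] : exists2 a, a \in N & forall b, b \in N :\ a -> z b != 0.
  have [/existsP[a /andP[aN /eqP za]]|/existsPn nz] := boolP [exists a, (a \in N) && (z a == 0)].
    exists a => // b; rewrite in_setD1 -za => /andP[ba bN].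
    by apply: zI => //; apply: (subsetP NU).
  exists a0 => // b; rewrite in_setD1 => /andP[_ bN].
  by have := nz b; rewrite bN.
have Nk' : (#|N :\ a| < k)%N by move: Nk; rewrite (cardsD1 a N) aN.
apply: (@det_identity_step F n u v z N U a) => //.
- apply: IH => //.
  + exact: subset_trans (subsetDl _ _) NU.
  + move=> i j; rewrite in_setD1 => /andP[ia iN] jU ij; rewrite (negPf ia).
    case: (eqVneq j a) => ja; last exact: zI.
    by apply: zn0; rewrite in_setD1 ia.
  + move=> t; rewrite !inE; case: eqVneq => //= ta tU.
    by apply: zT; rewrite in_setD.
apply: IH => //.
- exact: setSD.
- move=> i j; rewrite !in_setD1 => /andP[_ iN] /andP[_ jU]; exact: zI.
- move=> t; rewrite !inE; case: eqVneq => //= ta tU.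
  by apply: zT; rewrite in_setD.
Qed.

(** * The two sides of the theorem as weighted cycle sums *)

Section RightHandSide.
Context (K : fieldType) (n : nat) (u v : K) (z : 'I_n -> K).

Lemma P_tilde_gaudin :
  P_tilde z u v = \det (gaudin_mx setT setT (wm u v z) (wg u z) z).
Proof.
rewrite /P_tilde; congr (\det _).
set Z := diag_mx _.
have -> : u%:MP%:M - Z = diag_mx (\row_i (u - z i)%:MP).
  by apply/matrixP=> i j; rewrite !mxE mpolyCB; case: eqVneq => // _; rewrite !mulr0n subr0.
rewrite mul_diag_mx /Z mul_diag_mx; apply/matrixP=> i j; rewrite !mxE !in_setT.
case: eqVneq => [_|ij]; rewrite ?(mulr1n, mulr0n) /wm /wg /wal /wbe.
  rewrite !(mpolyCM, mpolyCB, mpolyCD, mpolyCN); ring.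
rewrite sub0r subr0 -!mpolyCM -mpolyCN -mpolyCM; congr (_%:MP).
ring.
Qed.

Lemma subst_P_tilde : injective z ->
  subst_galg (KZ z) (P_tilde z u v) = wcycsum setT (wal u z) (wbe z) v.
Proof.
move=> zI; have sep : separated setT setT z.
  by move=> a b _ _; apply: contra_neq => /zI.
have eH : kz setT setT z =1 KZ z.
  move=> a; rewrite /kz in_setT /kz_on /KZ; apply: eq_bigl => b.
  by rewrite !inE andbT.
have := gaudin_det_identity u v (subxx _) sep.
rewrite /det_identity setDv cards0 expr0 scale1r cycsum0 mul1r => <-; last first.
  by move=> t; rewrite in_set0.
rewrite -detvalE // -P_tilde_gaudin /ev /subst_galg /mmap.
apply: eq_bigr => m _; congr (_ * _); apply: eq_bigr => a _.
by rewrite eH.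
Qed.
End RightHandSide.

Section LeftHandSide.
Context (K : fieldType) (n : nat).
Local Notation A := (galg K 'S_n).
Implicit Types (R U E D : {set 'I_n}) (v w u : K).
Local Notation altsum R := (cycsum R (1 : K)).

Lemma transp_cycsum1 a b R : a \in R -> b \in R -> a != b ->
  transp K a b * altsum R = - altsum R.
Proof.
move=> aR bR ab; rewrite /cycsum mulr_sumr -sumrN.
rewrite [RHS](reindex_inj (mulgI (tperm a b))) /=.
have tR : perm_on R (tperm a b).
  by apply/subsetP=> c; rewrite inE; case: tpermP => [->|->|_ _ /eqP].
have onE s : perm_on R (tperm a b * s)%g = perm_on R s.
  apply/idP/idP=> sR; last exact: perm_onM.
  by rewrite -(mulKg (tperm a b) s) tpermV; apply: perm_onM.
apply: eq_big => [s|s sR]; first by rewrite onE.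
rewrite -scalerAr -gbaseM -scaleNr !expr1n !mulr1; congr (_ *: _).
by rewrite odd_permM odd_tperm ab signr_addb expr1 mulN1r opprK.
Qed.

Lemma cycsum_mul_cycsum1 E R w : E \subset R ->
  cycsum E w * altsum R = (\prod_(0 <= j < #|E|) (w + j%:R)) *: altsum R.
Proof.
have [k] := ubnP #|E|; elim: k => // k IH in E *; rewrite ltnS => Ek ER.
have [->|[a aE]] := set_0Vmem E.
  by rewrite cycsum0 mul1r cards0 big_geq ?scale1r.
have aE' : a \notin E :\ a by rewrite setD11.
rewrite -{1}(setD1K aE) cycsum_rec // -mulrA IH; last first.
- exact: subset_trans (subsetDl _ _) ER.
- by move: Ek; rewrite (cardsD1 a E) aE.
rewrite (cardsD1 a E) aE add1n big_nat_recr //= -[RHS]scalerA -scalerAr; congr (_ *: _).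
rewrite mulrBl -scalerAl mul1r scalerDl; congr (_ + _).
rewrite /jm mulr_suml -sumrN (eq_bigr (fun _ => altsum R : A)).
  by rewrite sumr_const scaler_nat.
move=> b; rewrite in_setD1 => /andP[ba bE].
by rewrite transp_cycsum1 ?opprK ?(subsetP ER) // eq_sym.
Qed.

Definition avoids R : 'I_n -> K := fun b => (b \notin R)%:R.

(** The weights [avoids R] and 1 give weight [v + 1] to the cycles that avoid
    [R], and 1 to the others.  Both sides obey the recursion of parameter [v + 1]
    when points outside [R] are added. *)
Lemma cycsum_mul_wcycsum U R v : R \subset U ->
  cycsum U (v + 1) * altsum R
  = (\prod_(0 <= j < #|R|) (v + 1 + j%:R)) *: wcycsum U (avoids R) (fun=> 1) v.
Proof.
have [k] := ubnP #|U|; elim: k => // k IH in U *; rewrite ltnS => Uk RU.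
have [UR|/subsetPn[a aU aR]] := boolP (U \subset R).
  have -> : U = R by apply/eqP; rewrite eqEsubset UR.
  rewrite cycsum_mul_cycsum1 //; congr (_ *: _).
  rewrite /wcycsum (bigD1 set0) ?sub0set //= [X in _ + X]big1 ?addr0 => [|D /andP[DR D0]].
    by rewrite big_set0 setD0 big1 // mulr1 scale1r cycsum0 mul1r.
  have /set0Pn[i iD] := D0.
  by rewrite (bigD1 i) //= /avoids (subsetP DR) //= !mul0r scale0r.
have aU' : a \notin U :\ a by rewrite setD11.
have RU' : R \subset U :\ a by rewrite subsetD1 RU.
rewrite -(setD1K aU) cycsum_rec // -mulrA IH //; last first.
  by move: Uk; rewrite (cardsD1 a U) aU.
rewrite -scalerAr -wcycsum_lead // wcycsum_setU1 //; congr (_ *: _).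
by rewrite /avoids aR !scale1r.
Qed.

(** [wcycsum] is linear in each pair of weights of a point, and
    [(u - z b, - z b) = - u * (0, 1) + (u - z b) * (1, 1)]. *)
Lemma wcycsum_split v u (z : 'I_n -> K) :
  \sum_(R : {set 'I_n}) ((- u) ^+ #|R| * \prod_(b | b \notin R) (u - z b))
     *: wcycsum setT (avoids R) (fun=> 1) v
  = wcycsum setT (wal u z) (wbe z) v.
Proof.
rewrite /wcycsum; under eq_bigr => R _ do rewrite scaler_sumr.
rewrite exchange_big /=; apply: eq_bigr => D _.
under eq_bigr => R _ do rewrite scalerA.
rewrite -scaler_suml; congr (_ *: _).
transitivity (\prod_i (- u * (i \notin D)%:R + wal u z i)); last first.
  rewrite (bigID (mem D)) /=; congr (_ * _).
    by apply: eq_bigr => i ->; rewrite mulr0 add0r.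
  apply: eq_big => [i|i /negPf iD]; first by rewrite !inE andbT.
  by rewrite iD mulr1 /wal /wbe; ring.
rewrite bigA_distr; apply: eq_bigr => R _.
have -> : \prod_(i in D) avoids R i = \prod_(i in R) (i \notin D)%:R.
  rewrite big_mkcond [RHS]big_mkcond; apply: eq_bigr => i _.
  by rewrite /avoids; case: (i \in D); case: (i \in R).
rewrite big1_eq mulr1 mulrAC -prodr_const -big_split /=.
rewrite [RHS](bigID (mem R)) /=; congr (_ * _).
  by apply: eq_bigr => i ->.
by apply: eq_bigr => i /negPf ->.
Qed.

Lemma sum_nonempty_card (V : nmodType) (F : {set 'I_n} -> V) :
  \sum_(R : {set 'I_n} | R != set0) F R
  = \sum_(1 <= i < n.+1) \sum_(R : {set 'I_n} | #|R| == i) F R.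
Proof.
rewrite (exchange_big_dep predT) //= big_mkcond; apply: eq_bigr => R _.
rewrite (eq_bigl (fun i => i == #|R|)) => [|i]; last by rewrite eq_sym.
rewrite (big_nat1_eq +%R (fun=> F R)) ltnS -cards_eq0 -lt0n.
have -> : (#|R| <= n)%N by rewrite -[X in (_ <= X)%N](card_ord n) max_card.
by rewrite andbT.
Qed.

Lemma Phi_tilde_subsets (chi : intpart n -> A) (z : 'I_n -> K) u v :
  (forall j, v + j.+1%:R != 0) ->
  Pi chi (v + 1) = cycsum setT (v + 1) ->
  (forall i, (0 < i <= n)%N -> Phi z i u
     = \sum_(R : {set 'I_n} | #|R| == i)
         (\prod_(b | b \notin R) (u - z b)) *: altsum R) ->
  Phi_tilde chi z u v = wcycsum setT (wal u z) (wbe z) v.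
Proof.
move=> vn0 PiE PhiE; rewrite /Phi_tilde PiE -wcycsum_split.
pose c R := ((- u) ^+ #|R| * \prod_(b | b \notin R) (u - z b))
  * \prod_(0 <= j < #|R|) (v + 1 + j%:R)^-1.
have termE R : ((- u) ^+ #|R| * \prod_(b | b \notin R) (u - z b))
     *: wcycsum setT (avoids R) (fun=> 1) v = cycsum setT (v + 1) * (c R *: altsum R).
  rewrite -scalerAr cycsum_mul_wcycsum ?subsetT // scalerA; congr (_ *: _).
  have inv1 : \prod_(0 <= j < #|R|) (v + 1 + j%:R)^-1
      * \prod_(0 <= j < #|R|) (v + 1 + j%:R) = 1.
    rewrite -big_split big1 // => j _.
    by rewrite /= mulVf // -addrA -[1]/(1%:R) -natrD add1n.
  by rewrite /c -[RHS]mulrA inv1 mulr1.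
rewrite (eq_bigr _ (fun R _ => termE R)) -mulr_sumr; congr (_ * _).
rewrite (bigD1 set0) //=; congr (_ + _).
  rewrite /c cards0 expr0 mul1r big_geq // mulr1 cycsum0.
  by congr (_ *: _); apply: eq_bigl => b; rewrite in_set0.
rewrite sum_nonempty_card; apply: eq_big_nat => i /andP[i0 iN].
rewrite PhiE ?i0 // scaler_sumr; apply: eq_bigr => R /eqP iR.
rewrite scalerA /c iR; congr (_ *: _).
rewrite mulrAC; congr (_ * _ * _); rewrite big_add1 /=.
by apply: eq_bigr => j _; rewrite -addrA -[1]/(1%:R) -natrD add1n.
Qed.
End LeftHandSide.

(** * Antisymmetrizers of subsets *)

Section Embedding.
Context (m n : nat) (r : 'I_m -> 'I_n) (rI : injective r).
Implicit Types (s t : 'S_m).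

Lemma sym_emb_in s k : sym_emb r s (r k) = r (s k).
Proof.
rewrite sym_embE // /sym_emb_fun; case: pickP => [l /eqP/rI->//|/(_ k)].
by rewrite eqxx.
Qed.

Lemma sym_emb_out s a : a \notin codom r -> sym_emb r s a = a.
Proof.
rewrite sym_embE // /sym_emb_fun; case: pickP => [l /eqP <-|//].
by rewrite codom_f.
Qed.

Lemma sym_embM s t : sym_emb r (s * t)%g = (sym_emb r s * sym_emb r t)%g.
Proof.
apply/permP=> a; rewrite permM; have [/codomP[k ->]|aR] := boolP (a \in codom r).
  by rewrite !sym_emb_in permM.
by rewrite !sym_emb_out.
Qed.

Lemma sym_emb1 : sym_emb r 1%g = 1%g.
Proof. by apply: (mulgI (sym_emb r 1%g)); rewrite -sym_embM !mulg1. Qed.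

Lemma sym_emb_tperm k l : sym_emb r (tperm k l) = tperm (r k) (r l).
Proof.
apply/permP=> a; have [/codomP[j ->]|aR] := boolP (a \in codom r).
  rewrite sym_emb_in; case: tpermP => [->|->|jk jl]; rewrite ?tpermL ?tpermR //.
  by rewrite tpermD // (inj_eq rI) eq_sym; apply/eqP.
rewrite sym_emb_out // tpermD //.
  by apply: contraNneq aR => <-; apply: codom_f.
by apply: contraNneq aR => <-; apply: codom_f.
Qed.

Lemma odd_sym_emb s : odd_perm (sym_emb r s) = odd_perm s.
Proof.
have [ts -> _] := prod_tpermP s; elim: ts => [|p ts IH].
  by rewrite !big_nil sym_emb1 !odd_perm1.
rewrite !big_cons sym_embM !odd_permM IH sym_emb_tperm !odd_tperm.
by rewrite (inj_eq rI).
Qed.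

Lemma sym_emb_inj : injective (sym_emb r).
Proof.
move=> s t est; apply/permP=> k; apply: rI.
by rewrite -!sym_emb_in est.
Qed.

Lemma sym_emb_image :
  [set sym_emb r s | s in 'S_m] = [set t | perm_on [set a in codom r] t].
Proof.
apply/eqP; rewrite eqEcard; apply/andP; split.
  apply/subsetP=> _ /imsetP[s _ ->]; rewrite inE; apply/subsetP=> a.
  by rewrite !inE; apply: contraNT => aR; rewrite sym_emb_out.
rewrite card_imset; last exact: sym_emb_inj.
by rewrite cardsE card_perm cardsE card_codom // card_Sn card_ord.
Qed.

Lemma antisymE (K : fieldType) s :
  antisym K m s = (m`!%:R)^-1 * (-1) ^+ s.
Proof.
rewrite /antisym; set c := _^-1; move: c => c.
rewrite [LHS]ffunE sum_ffunE; congr (_ * _).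
rewrite (bigD1 s) //= big1 ?addr0 => [|t ts].
  by rewrite [LHS]ffunE [gbase _ _ _]ffunE eqxx mulr1.
by rewrite [LHS]ffunE [gbase _ _ _]ffunE eq_sym (negPf ts) mulr0.
Qed.

Lemma emb_antisym (K : fieldType) : m`!%:R != 0 :> K ->
  m`!%:R *: galg_emb r (antisym K m) = cycsum [set a in codom r] (1 : K).
Proof.
move=> m0; rewrite /galg_emb scaler_sumr.
transitivity (\sum_(s : 'S_m) (-1) ^+ s *: gbase K (sym_emb r s)).
  apply: eq_bigr => s _; rewrite antisymE scalerA; congr (_ *: _).
  by move: m0; move: (m`!%:R) => c c0; rewrite mulrA mulfV ?mul1r.
transitivity (\sum_(t in [set sym_emb r s | s in 'S_m]) (-1) ^+ t *: gbase K t).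
  rewrite big_imset /=; last by move=> s t _ _; apply: sym_emb_inj.
  by apply: eq_bigr => s _; rewrite odd_sym_emb.
rewrite sym_emb_image /cycsum; apply: eq_big => [t|t _]; first by rewrite inE.
by rewrite expr1n mulr1.
Qed.

End Embedding.

Section Increasing.
Context (m n : nat).
Implicit Types (r : {ffun 'I_m -> 'I_n}).

Lemma strictly_increasing_inj r : strictly_increasing r -> injective r.
Proof.
move=> /forallP r_lt j k e; apply: ord_inj.
have not_lt j' k' : r j' = r k' -> ~~ (j' < k')%N.
  move=> e'; apply/negP=> lt.
  by have /forallP/(_ k')/implyP/(_ lt) := r_lt j'; rewrite e' ltnn.
by apply/eqP; rewrite eqn_leq [(j <= k)%N]leqNgt [(k <= j)%N]leqNgt !not_lt.
Qed.

Lemma sorted_strictly_increasing r : strictly_increasing r ->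
  sorted ltn [seq val (r j) | j <- enum 'I_m].
Proof.
move=> /forallP r_lt; rewrite sorted_map.
have : sorted (relpre val ltn) (enum 'I_m).
  by rewrite -sorted_map val_enum_ord iota_ltn_sorted.
apply: sub_sorted => j k /=; exact: (implyP (forallP (r_lt j) k)).
Qed.

Lemma strictly_increasing_codom_inj r r' :
  strictly_increasing r -> strictly_increasing r' ->
  [set a in codom r] = [set a in codom r'] -> r = r'.
Proof.
move=> ri ri' e.
have : [seq val (r j) | j <- enum 'I_m] = [seq val (r' j) | j <- enum 'I_m].
  apply: (irr_sorted_eq ltn_trans ltnn); rewrite ?sorted_strictly_increasing //.
  move=> i; rewrite (map_comp val r) (map_comp val r').
  have emem : map r (enum 'I_m) =i map r' (enum 'I_m).
    by move=> a; move/setP/(_ a): e; rewrite !inE.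
  by apply/mapP/mapP=> -[a aR ->]; exists a => //; rewrite ?emem // -emem.
move=> /eq_in_map er; apply/ffunP=> j; apply: val_inj; apply: er.
by rewrite mem_enum.
Qed.

Lemma increasing_exists (R : {set 'I_n}) : #|R| = m ->
  exists2 r : {ffun 'I_m -> 'I_n}, strictly_increasing r & [set a in codom r] = R.
Proof.
move=> cR; pose r := [ffun j : 'I_m => enum_val (cast_ord (esym cR) j)].
exists r; last first.
  apply/setP=> a; rewrite inE; apply/codomP/idP => [[j ->]|aR].
    by rewrite ffunE enum_valP.
  exists (cast_ord cR (enum_rank_in aR a)).
  by rewrite ffunE cast_ordK enum_rankK_in.
have srt : sorted ltn (map val (enum R)).
  rewrite {1}/enum_mem -enumT; apply: (subseq_sorted ltn_trans (s2 := map val (enum 'I_n))).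
    by apply/map_subseq/filter_subseq.
  by rewrite val_enum_ord iota_ltn_sorted.
apply/forallP=> j; apply/forallP=> k; apply/implyP=> jk; rewrite !ffunE.
have a := enum_val (cast_ord (esym cR) j).
have szR (i : 'I_m) : (i < size (enum R))%N.
  by have := ltn_ord i; rewrite -cardE -[X in (_ < X)%N]cR.
rewrite !(enum_val_nth a) /= -!(nth_map a 0%N val) ?szR //.
by apply: (sorted_ltn_nth ltn_trans); rewrite ?inE ?size_map.
Qed.
End Increasing.

Lemma Phi_subsets (K : fieldType) (n : nat) (z : 'I_n -> K) i u :
  i`!%:R != 0 :> K ->
  Phi z i u = \sum_(R : {set 'I_n} | #|R| == i)
    (\prod_(b | b \notin R) (u - z b)) *: cycsum R (1 : K).
Proof.
move=> i0; rewrite /Phi.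
rewrite (partition_big (fun r : {ffun 'I_i -> 'I_n} => [set a in codom r])
  (fun R => #|R| == i)) /=; last first.
  move=> r /strictly_increasing_inj rI.
  by rewrite cardsE card_codom // card_ord.
apply: eq_bigr => R /eqP /increasing_exists[r0 ir0 cr0].
rewrite (big_pred1 r0) => [|r]; last first.
  apply/andP/eqP=> [[ir /eqP cr]|->]; last by rewrite ir0 cr0.
  by apply: strictly_increasing_codom_inj; rewrite // cr.
rewrite emb_antisym //; last exact: strictly_increasing_inj.
rewrite cr0; congr (_ *: _); apply: eq_bigl => b.
by rewrite -cr0 inE.
Qed.

(** * Content eigenvalues of Young symmetrizers *)

Section RowReading.
Implicit Types (sh : seq nat) (d i : nat).

Lemma reshape_cons_lt d sh i : (i < d)%N ->
  reshape_index (d :: sh) i = 0%N /\ reshape_offset (d :: sh) i = i.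
Proof.
by move=> lt; rewrite /reshape_offset /reshape_index /= subn_eq0 lt /= subn0.
Qed.

Lemma reshape_cons_ge d sh i :
  reshape_index (d :: sh) (d + i) = (reshape_index sh i).+1 /\
  reshape_offset (d :: sh) (d + i) = reshape_offset sh i.
Proof.
rewrite /reshape_offset /reshape_index /= subn_eq0 ltnNge leq_addr /=.
by rewrite -addnS addKn subnDl.
Qed.

Lemma prod_boxes (R : comNzRingType) sh (f : nat -> nat -> R) :
  \prod_(0 <= k < sumn sh) f (reshape_index sh k) (reshape_offset sh k)
  = \prod_(0 <= i < size sh) \prod_(0 <= j < nth 0%N sh i) f i j.
Proof.
elim: sh f => [|d sh IH] f /=; first by rewrite !big_geq.
rewrite (@big_cat_nat _ _ _ d) //= ?leq_addr // big_nat_recl //=; congr (_ * _).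
  by apply: eq_big_nat => k /andP[_ /reshape_cons_lt-/(_ sh)[-> ->]].
rewrite -{1}[d]add0n big_addn addKn -(IH (fun i => f i.+1)).
by apply: eq_bigr => k _; rewrite addnC; have [-> ->] := reshape_cons_ge d sh k.
Qed.
End RowReading.

Section YoungSymmetrizer.
Context (F : fieldType) (n : nat).
Local Notation A := (galg F 'S_n).
Implicit Types (R : {set 'I_n}) (s p : 'S_n).

(** For [w = -1] the sign and the power of [w] combine to a constant, so the
    recursion of [cycsum] also describes symmetrizers. *)
Lemma cycsumN1 R : cycsum R (-1 : F)
  = (-1) ^+ #|R| *: \sum_(s : 'S_n | perm_on R s) gbase F s.
Proof.
rewrite /cycsum scaler_sumr; apply: eq_bigr => s sR; congr (_ *: _).
have le := leq_card_fixed_porbits sR.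
rewrite -signr_odd /odd_perm card_ord -[X in _ * X]signr_odd oddB //.
rewrite -signr_addb -[RHS]signr_odd; congr (_ ^+ nat_of_bool _).
have : odd (#|R| + #|~: R|) = odd n by rewrite cardsC card_ord.
by rewrite oddD => <-; case: (odd #|R|); case: (odd #|~: R|); case: (odd #|porbits s|).
Qed.

Lemma cycsumN1_transp R a b : a \in R -> b \in R ->
  cycsum R (-1) * transp F a b = cycsum R (-1).
Proof.
move=> aR bR; rewrite cycsumN1 -scalerAl; congr (_ *: _).
rewrite mulr_suml [RHS](reindex_inj (mulIg (tperm a b))) /=.
have tR : perm_on R (tperm a b).
  by apply/subsetP=> c; rewrite inE; case: tpermP => [->|->|_ _ /eqP].
have onE s : perm_on R (s * tperm a b)%g = perm_on R s.
  apply/idP/idP=> sR; last exact: perm_onM.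
  by rewrite -(mulgK (tperm a b) s) tpermV; apply: perm_onM.
by apply: eq_big => [s|s _]; rewrite ?onE ?gbaseM.
Qed.

Context (la : intpart n).
Local Notation row := (tab_row la).
Local Notation col := (tab_col la).
Local Notation sh := (parts la).

Lemma size_parts : size sh = n.
Proof. by rewrite size_map size_tuple. Qed.

Lemma sumn_parts : sumn sh = n.
Proof. by case/andP: (valP la) => _ /eqP. Qed.

Lemma parts_geq i j : (i <= j)%N -> (nth 0 sh j <= nth 0 sh i)%N.
Proof.
have [srt _] := andP (valP la).
have [ltj|lej] := ltnP j (size sh); last by rewrite nth_default.
have geq_tr : transitive geq by move=> x y t /= yx ty; apply: leq_trans ty yx.
move=> ij; have := sorted_leq_nth geq_tr leqnn 0%N srt.
by apply; rewrite ?inE ?(leq_ltn_trans ij).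
Qed.

Lemma tab_box (k : 'I_n) : flatten_index sh (row k) (col k) = k.
Proof. exact: reshape_indexK. Qed.

Lemma tab_col_lt (k : 'I_n) : (col k < nth 0 sh (row k))%N.
Proof. by apply: reshape_offsetP; rewrite sumn_parts. Qed.

Lemma box_exists r c : (c < nth 0 sh r)%N ->
  exists2 k : 'I_n, row k = r & col k = c.
Proof.
move=> lt; have kn : (flatten_index sh r c < n)%N.
  by rewrite -[X in (_ < X)%N]sumn_parts flatten_indexP.
by exists (Ordinal kn); [apply: flatten_indexKl | apply: flatten_indexKr].
Qed.

Lemma tab_inj (j k : 'I_n) : row j = row k -> col j = col k -> j = k.
Proof. by move=> er ec; apply: ord_inj; rewrite -(tab_box j) -(tab_box k) er ec. Qed.

Lemma tab_lt (j k : 'I_n) :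
  (j < k)%N = (row j < row k)%N || (row j == row k) && (col j < col k)%N.
Proof.
rewrite ltnNge (reshape_leq sh) -/(row j) -/(row k) -/(col j) -/(col k).
by case: (ltngtP (row j) (row k)) => _ //=; rewrite -ltnNge.
Qed.

Definition row_perm s := [forall k, row (s k) == row k].
Definition col_perm s := [forall k, col (s k) == col k].
Definition row_sum : A := \sum_(s : 'S_n | row_perm s) gbase F s.
Definition col_sum : A := \sum_(s : 'S_n | col_perm s) (-1) ^+ s *: gbase F s.

Lemma young_symmetrizerE : young_symmetrizer F la = row_sum * col_sum.
Proof. by []. Qed.

Lemma row_permM s p : row_perm s -> row_perm (s * p)%g = row_perm p.
Proof.
move=> /forallP rs; apply/forallP/forallP => rp k.
  have := rp (s^-1%g k); rewrite permM permKV => /eqP ->.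
  by have := rs (s^-1%g k); rewrite permKV eq_sym.
by rewrite permM (eqP (rp _)) (eqP (rs _)).
Qed.

Lemma col_permM s p : col_perm s -> col_perm (s * p)%g = col_perm p.
Proof.
move=> /forallP rs; apply/forallP/forallP => rp k.
  have := rp (s^-1%g k); rewrite permM permKV => /eqP ->.
  by have := rs (s^-1%g k); rewrite permKV eq_sym.
by rewrite permM (eqP (rp _)) (eqP (rs _)).
Qed.

Lemma row_sum_absorb s : row_perm s -> gbase F s * row_sum = row_sum.
Proof.
move=> rs; rewrite /row_sum mulr_sumr [RHS](reindex_inj (mulgI s)) /=.
by apply: eq_big => [p|p _]; rewrite ?row_permM ?gbaseM.
Qed.

Lemma row_perm_tperm j k : row j = row k -> row_perm (tperm j k).
Proof.
by move=> e; apply/forallP=> i; case: tpermP => [->|->|_ _] //; rewrite e.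
Qed.

Lemma col_sum_absorb j k : j != k -> col j = col k ->
  transp F j k * col_sum = - col_sum.
Proof.
move=> jk e; have ct : col_perm (tperm j k).
  by apply/forallP=> i; case: tpermP => [->|->|_ _] //; rewrite e.
rewrite /col_sum mulr_sumr -sumrN [RHS](reindex_inj (mulgI (tperm j k))) /=.
apply: eq_big => [p|p _]; first by rewrite col_permM.
rewrite -scalerAr -gbaseM odd_permM odd_tperm jk signr_addb expr1.
by rewrite mulN1r scaleNr opprK.
Qed.

Hypothesis char0 : forall m, m.+1%:R != 0 :> F.

Definition tab_rowset r : {set 'I_n} := [set j | row j == r].

(** The left factor turns the symmetrizer of the row [r] into that of
    [k |: row r].  The latter kills [gbase F p * col_sum] for every row
    permutation [p], because the column of the box [p k] meets the row [r],
    which is at least as long as the row of [k]. *)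
Lemma earlier_row_sum (k : 'I_n) r : (r < row k)%N ->
  (1 + jm F k (tab_rowset r)) * young_symmetrizer F la = 0.
Proof.
move=> rk; set R := tab_rowset r.
have kR : k \notin R by rewrite inE gtn_eqF.
have Rrow s : perm_on R s -> row_perm s.
  move=> sR; apply/forallP=> j; have [jR|jR] := boolP (j \in R); last first.
    by rewrite (out_perm sR).
  have : s j \in R by rewrite perm_closed.
  by move: jR; rewrite !inE => /eqP -> /eqP ->.
have absorb : cycsum R (-1) * row_sum = ((-1) ^+ #|R| * (#|R|`!)%:R) *: row_sum.
  rewrite cycsumN1 -scalerAl -scalerA; congr (_ *: _).
  rewrite mulr_suml (eq_bigr (fun _ => row_sum)) => [|s /Rrow]; last first.
    exact: row_sum_absorb.
  by rewrite sumr_const card_perm scaler_nat.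
have kill : cycsum (k |: R) (-1) * (row_sum * col_sum) = 0.
  have -> : row_sum * col_sum = \sum_(p | row_perm p) gbase F p * col_sum.
    by rewrite /row_sum big_distrl.
  rewrite big_distrr big1 //= => p /forallP rp.
  have [i ir ic] : exists2 i, row i = r & col i = col (p k).
    apply: box_exists; apply: leq_trans (tab_col_lt (p k)) _.
    by apply: parts_geq; rewrite (eqP (rp k)) ltnW.
  set j := p^-1%g i; have pj : p j = i by rewrite permKV.
  have jR : j \in R by rewrite inE -(eqP (rp j)) pj ir.
  set Z := _ * (_ * _).
  have ZN : Z = - Z.
    rewrite {1}/Z -(@cycsumN1_transp _ k j) ?setU11 ?in_setU1 ?jR ?orbT //.
    rewrite -mulrA [transp F k j * _]mulrA transp_gbase pj -[gbase F p * _ * _]mulrA.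
    rewrite col_sum_absorb ?mulrN //.
    by apply: contraNneq kR => pki; rewrite inE -(eqP (rp k)) pki ir.
  apply/eqP; have /eqP : Z + Z = 0 by rewrite {1}ZN addNr.
  rewrite -mulr2n -scaler_nat scaler_eq0.
  by rewrite (negPf (char0 1)) => /= /eqP ->.
rewrite young_symmetrizerE.
have X : (1 + jm F k R) * cycsum R (-1) = - cycsum (k |: R) (-1).
  by rewrite cycsum_rec // scaleN1r -mulNr opprB opprK addrC.
have c0 : (-1) ^+ #|R| * (#|R|`!)%:R != 0 :> F.
  by rewrite mulf_neq0 ?signr_eq0 // -(prednK (fact_gt0 _)) char0.
apply/eqP; move: (congr1 (fun x => x * (row_sum * col_sum)) X).
rewrite mulNr kill oppr0 -mulrA [cycsum R _ * _]mulrA absorb -!scalerAl -scalerAr.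
by move/eqP; rewrite scaler_eq0 (negPf c0).
Qed.

Lemma card_left_boxes (k : 'I_n) :
  #|[set j : 'I_n | (row j == row k) && (col j < col k)%N]| = col k.
Proof.
have box (c : 'I_(col k)) : (flatten_index sh (row k) c < n)%N.
  rewrite -[X in (_ < X)%N]sumn_parts flatten_indexP //.
  exact: ltn_trans (ltn_ord c) (tab_col_lt k).
pose f c := Ordinal (box c).
have rowf c : row (f c) = row k.
  by apply: flatten_indexKl; apply: ltn_trans (ltn_ord c) (tab_col_lt k).
have colf c : col (f c) = c.
  by apply: flatten_indexKr; apply: ltn_trans (ltn_ord c) (tab_col_lt k).
have fI : injective f by move=> c d e; apply: ord_inj; rewrite -!colf e.
rewrite -[RHS]card_ord -(card_imset _ fI); apply: eq_card => j.
rewrite inE; apply/andP/imsetP => [[/eqP rj cj]|[c _ ->]].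
  by exists (Ordinal cj) => //; apply: tab_inj; rewrite ?rowf ?colf.
by rewrite rowf colf eqxx ltn_ord.
Qed.

(** The boxes on the left of [k] in its row contribute 1 each, and each of the
    rows above contributes -1. *)
Lemma jm_young (k : 'I_n) :
  jm F k [set j : 'I_n | (j < k)%N] * young_symmetrizer F la
  = ((col k)%:R - (row k)%:R) *: young_symmetrizer F la.
Proof.
have -> : [set j : 'I_n | (j < k)%N]
    = [set j : 'I_n | (row j < row k)%N] :|: [set j : 'I_n | (row j == row k) && (col j < col k)%N].
  by apply/setP=> j; rewrite !inE tab_lt.
rewrite jmU; last first.
  rewrite -setI_eq0; apply/eqP/setP=> j; rewrite !inE.
  by case: ltngtP.
rewrite mulrDl scalerBl addrC; congr (_ + _).
  rewrite young_symmetrizerE mulrA scalerAl; congr (_ * _).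
  rewrite /jm mulr_suml (eq_bigr (fun _ => row_sum)) => [|j]; last first.
    by rewrite inE => /andP[/eqP e _]; apply/row_sum_absorb/row_perm_tperm.
  by rewrite sumr_const scaler_nat card_left_boxes.
suff rows m : (m <= row k)%N ->
    jm F k [set j : 'I_n | (row j < m)%N] * young_symmetrizer F la
    = - (m%:R *: young_symmetrizer F la) by apply: rows.
elim: m => [_|m IH mk].
  by rewrite scale0r oppr0 /jm big_pred0 ?mul0r // => j; rewrite inE.
have -> : [set j : 'I_n | (row j < m.+1)%N]
    = [set j : 'I_n | (row j < m)%N] :|: tab_rowset m.
  by apply/setP=> j; rewrite !inE ltnS leq_eqVlt orbC.
rewrite jmU; last first.
  by rewrite -setI_eq0; apply/eqP/setP=> j; rewrite !inE; case: ltngtP.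
have := earlier_row_sum mk; rewrite mulrDl mul1r => /eqP.
rewrite addr_eq0 => /eqP e.
rewrite mulrDl (IH (ltnW mk)) -addn1 natrD scalerDl opprD scale1r.
by rewrite {4}e opprK.
Qed.

Lemma cycsum_young w i : (i <= n)%N ->
  cycsum [set j : 'I_n | (j < i)%N] w * young_symmetrizer F la
  = (\prod_(0 <= k < i)
       (w + (reshape_index sh k)%:R - (reshape_offset sh k)%:R))
      *: young_symmetrizer F la.
Proof.
elim: i => [_|i IH lt_in].
  have -> : [set j : 'I_n | (j < 0)%N] = set0 by apply/setP=> j; rewrite !inE.
  by rewrite cycsum0 mul1r big_geq // scale1r.
pose k := Ordinal lt_in.
have -> : [set j : 'I_n | (j < i.+1)%N] = k |: [set j : 'I_n | (j < k)%N].
  by apply/setP=> j; rewrite !inE ltnS leq_eqVlt.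
rewrite cycsum_rec ?inE ?ltnn // -mulrA IH ?(ltnW lt_in) //.
rewrite -scalerAr mulrBl jm_young -scalerAl mul1r -scalerBl scalerA.
rewrite big_nat_recr //=; congr (_ * _ *: _).
by rewrite opprB addrA.
Qed.

Lemma cycsumT_young w :
  cycsum setT w * young_symmetrizer F la = Pi_part la w *: young_symmetrizer F la.
Proof.
have -> : setT = [set j : 'I_n | (j < n)%N] by apply/setP=> j; rewrite !inE ltn_ord.
rewrite cycsum_young //; congr (_ *: _); rewrite -{1}sumn_parts.
rewrite (prod_boxes sh (fun i j => w + i%:R - j%:R)) size_parts /Pi_part big_add1 /=.
apply: eq_bigr => i _; rewrite big_add1 /=; apply: eq_bigr => j _.
by rewrite -[i.+1]addn1 -[j.+1]addn1 !natrD; ring.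
Qed.

Lemma row_col_perm_eq1 s : row_perm s -> col_perm s -> s = 1%g.
Proof.
move=> /forallP rs /forallP cs; apply/permP=> k; rewrite perm1.
by apply: tab_inj; apply/eqP.
Qed.

(** Only the identity preserves both rows and columns. *)
Lemma young_symmetrizer_coef1 : young_symmetrizer F la 1%g = 1.
Proof.
have p1 : row_perm 1%g by apply/forallP=> k; rewrite perm1.
have c1 : col_perm 1%g by apply/forallP=> k; rewrite perm1.
have rowE s : row_sum s = (row_perm s)%:R.
  rewrite /row_sum sum_ffunE big_mkcond (bigD1 s) //= ffunE eqxx big1 ?addr0.
    by case: row_perm.
  by move=> p ps; case: ifP => // _; rewrite ffunE eq_sym (negPf ps).
have colE s : col_sum s = (col_perm s)%:R * (-1) ^+ s.
  rewrite /col_sum sum_ffunE big_mkcond (bigD1 s) //= !ffunE eqxx big1 ?addr0.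
    by case: col_perm; rewrite ?mul1r ?mulr1 ?mul0r.
  by move=> p ps; case: ifP => // _; rewrite !ffunE eq_sym (negPf ps) mulr0.
rewrite young_symmetrizerE ffunE (bigD1 1%g) //= big1 ?addr0.
  by rewrite invg1 mulg1 rowE colE p1 c1 odd_perm1 !mul1r.
move=> s s1; rewrite rowE colE mulg1.
case rs: (row_perm s); last by rewrite mul0r.
case cs: (col_perm s^-1%g); last by rewrite mul0r mulr0.
have cs' : col_perm s by rewrite -(col_permM _ cs) mulVg.
by move: s1; rewrite (row_col_perm_eq1 rs cs') eqxx.
Qed.

Lemma young_symmetrizer_neq0 : young_symmetrizer F la != 0.
Proof.
apply/eqP=> /(congr1 (fun x : A => x 1%g)); rewrite young_symmetrizer_coef1 ffunE.
by apply/eqP; rewrite oner_eq0.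
Qed.

End YoungSymmetrizer.

(** * Cycle types and conjugacy *)

Section CycleType.
Context (n : nat).
Implicit Types (s t : 'S_n) (C : {set 'I_n}).
Local Open Scope nat_scope.

Definition cycles s : seq {set 'I_n} :=
  sort (relpre (fun C => #|C|) geq) (enum (porbits s)).

Definition cycle_sizes s : seq nat := [seq #|C| | C : {set 'I_n} <- cycles s].

Definition cycle_list s C : seq 'I_n :=
  if [pick x in C] is Some x then traject s x #|C| else [::].

(** Read as one sequence, the cycles by decreasing size list all points in such a
    way that the position of [s a] depends only on the position of [a] and on
    the sizes ([nth_next_pos]). *)
Definition cycle_word s : seq (seq 'I_n) := [seq cycle_list s C | C <- cycles s].

Lemma mem_cycles s C : (C \in cycles s) = (C \in porbits s).
Proof. by rewrite mem_sort mem_enum. Qed.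

Lemma cycle_listP s C : C \in porbits s ->
  exists2 x, C = porbit s x & cycle_list s C = traject s x #|C|.
Proof.
case/imsetP=> y _ ->; rewrite /cycle_list; case: pickP => [x xC|/(_ y)].
  by exists x => //; apply/eqP; rewrite eq_porbit_mem porbit_sym.
by rewrite porbit_id.
Qed.

Lemma shape_cycle_word s : shape (cycle_word s) = cycle_sizes s.
Proof.
rewrite /shape /cycle_word -map_comp; apply/eq_in_map => C.
by rewrite mem_cycles => /cycle_listP[x _ /= ->]; rewrite size_traject.
Qed.

Lemma sorted_cycle_sizes s : sorted geq (cycle_sizes s).
Proof.
rewrite /cycle_sizes /cycles -sort_map; apply: sort_sorted => x y /=.
exact: leq_total.
Qed.

Lemma sumn_cycle_sizes s : sumn (cycle_sizes s) = n.
Proof.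
have -> : sumn (cycle_sizes s) = sumn [seq #|C| | C : {set 'I_n} <- enum (porbits s)].
  by apply: perm_sumn; apply: perm_map; rewrite perm_sort.
rewrite sumnE big_map big_enum /= -[RHS]card_ord -sum1_card.
rewrite (partition_big_imset (porbit s)) /=; apply: eq_bigr => C /imsetP[x _ ->].
rewrite -sum1_card; apply: eq_bigl => y.
by rewrite eq_porbit_mem.
Qed.

Lemma cycle_sizes_gt0 s : all (leq 1) (cycle_sizes s).
Proof.
apply/allP=> m /mapP[C]; rewrite mem_cycles => /cycle_listP[x -> _] ->.
by rewrite lt0n card_porbit_neq0.
Qed.

Lemma mem_cycle_word s (a : 'I_n) : a \in flatten (cycle_word s).
Proof.
have aC : porbit s a \in porbits s by apply: imset_f.
have [x ax e] := cycle_listP aC.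
apply/flattenP; exists (cycle_list s (porbit s a)).
  by apply: map_f; rewrite mem_cycles.
by rewrite e ax -porbit_traject -ax porbit_id.
Qed.

Lemma size_cycle_word s : size (flatten (cycle_word s)) = n.
Proof. by rewrite size_flatten shape_cycle_word sumn_cycle_sizes. Qed.

Lemma uniq_cycle_word s : uniq (flatten (cycle_word s)).
Proof.
apply: (leq_size_uniq (enum_uniq 'I_n)) => [a _|]; first exact: mem_cycle_word.
by rewrite size_cycle_word size_enum_ord.
Qed.

Definition next_pos (sz : seq nat) (i : nat) : nat :=
  let r := reshape_index sz i in let c := reshape_offset sz i in
  flatten_index sz r (if c.+1 < nth 0 sz r then c.+1 else 0).

Lemma next_pos_lt sz i : i < sumn sz -> next_pos sz i < sumn sz.
Proof.
move=> lt; apply: flatten_indexP; case: ifP => // _.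
exact: leq_ltn_trans (reshape_offsetP lt).
Qed.

Lemma nth_next_pos s x0 i : i < n ->
  s (nth x0 (flatten (cycle_word s)) i)
  = nth x0 (flatten (cycle_word s)) (next_pos (cycle_sizes s) i).
Proof.
move=> lt; set sz := cycle_sizes s.
have lt' : i < sumn sz by rewrite sumn_cycle_sizes.
have rlt : reshape_index sz i < size (cycles s).
  by rewrite -(size_map (fun C : {set 'I_n} => #|C|)) reshape_indexP.
have clt := reshape_offsetP lt'.
rewrite !nth_flatten shape_cycle_word -/sz /next_pos.
set r := reshape_index sz i in rlt clt *; set c := reshape_offset sz i in clt *.
have c'lt : (if c.+1 < nth 0 sz r then c.+1 else 0) < nth 0 sz r.
  by case: ifP => // _; apply: leq_ltn_trans clt.
rewrite flatten_indexKl // flatten_indexKr // /cycle_word (nth_map set0) //.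
set C := nth set0 (cycles s) r.
have CP : C \in porbits s by rewrite -mem_cycles mem_nth.
have szr : nth 0 sz r = #|C| by rewrite /sz (nth_map set0).
rewrite szr in clt c'lt *; have [x Cx ->] := cycle_listP CP.
rewrite !(set_nth_default x x0) ?size_traject // !nth_traject // -iterS.
case: ltnP => // le.
have -> : c.+1 = #|C| by apply/eqP; rewrite eqn_leq clt.
by rewrite Cx iter_porbit.
Qed.

Lemma conj_of_cycle_sizes s t : cycle_sizes s = cycle_sizes t ->
  exists g : 'S_n, t = (s ^ g)%g.
Proof.
move=> e; pose ws := flatten (cycle_word s); pose wt := flatten (cycle_word t).
have idx a : index a ws < n by rewrite -[X in _ < X](size_cycle_word s) index_mem mem_cycle_word.
pose f (a : 'I_n) := nth a wt (index a ws).
have fI : injective f.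
  move=> a b; rewrite /f (set_nth_default a) ?size_cycle_word // => /eqP.
  rewrite nth_uniq ?size_cycle_word ?uniq_cycle_word // => /eqP eab.
  by rewrite -(nth_index a (mem_cycle_word s a)) -(nth_index a (mem_cycle_word s b)) -/ws eab.
exists (perm fI); apply/permP=> b.
rewrite -(permKV (perm fI) b); set a := (perm fI)^-1%g b.
rewrite conjgE !permM permK permE [in RHS]permE /f.
rewrite nth_next_pos // -e.
have -> : s a = nth a ws (next_pos (cycle_sizes s) (index a ws)).
  by rewrite -nth_next_pos // nth_index // mem_cycle_word.
have nlt : next_pos (cycle_sizes s) (index a ws) < n.
  by rewrite -[X in _ < X](sumn_cycle_sizes s) next_pos_lt // sumn_cycle_sizes.
rewrite index_uniq ?size_cycle_word ?uniq_cycle_word //.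
by apply: set_nth_default; rewrite size_cycle_word.
Qed.

Lemma size_cycle_sizes_le s : size (cycle_sizes s) <= n.
Proof.
rewrite -[X in _ <= X](sumn_cycle_sizes s); have := cycle_sizes_gt0 s.
elim: (cycle_sizes s) => //= d sz IH /andP[d0 /IH le].
by rewrite -add1n leq_add.
Qed.

Definition cycle_tuple s : n.-tuple 'I_n.+1 :=
  [tuple inord (nth 0 (cycle_sizes s) i) | i < n].

Lemma cycle_tupleE s : map val (cycle_tuple s)
  = cycle_sizes s ++ nseq (n - size (cycle_sizes s)) 0.
Proof.
have szn := size_cycle_sizes_le s.
apply: (@eq_from_nth _ 0) => [|i].
  by rewrite size_map size_tuple size_cat size_nseq subnKC.
rewrite size_map size_tuple => lt; rewrite nth_cat nth_nseq if_same.
have -> : i = Ordinal lt by [].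
rewrite (nth_map ord0) ?size_tuple // -tnth_nth tnth_mktuple.
have le_n : nth 0 (cycle_sizes s) i <= n.
  rewrite -[X in _ <= X](sumn_cycle_sizes s).
  elim: (cycle_sizes s) (i) => [|d sz IH] [|j] //=; first exact: leq_addr.
  exact: leq_trans (IH j) (leq_addl _ _).
rewrite /= inordK //; case: ltnP => // le.
by rewrite nth_default // size_map size_sort -cardE.
Qed.

Lemma cycle_tuple_intpart s : is_intpart (cycle_tuple s).
Proof.
rewrite /is_intpart cycle_tupleE sumn_cat sumn_nseq mul0n addn0 sumn_cycle_sizes eqxx andbT.
have geq_tr : transitive geq by move=> x y t /= yx ty; apply: leq_trans ty yx.
rewrite (sorted_pairwise geq_tr) pairwise_cat -(sorted_pairwise geq_tr) sorted_cycle_sizes /=.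
apply/andP; split.
  by apply/allrelP=> x y _; rewrite mem_nseq => /andP[_ /eqP ->].
by elim: (n - _) => //= k ->; rewrite all_nseq /= orbT.
Qed.

Definition cycle_type s : intpart n := exist _ (cycle_tuple s) (cycle_tuple_intpart s).

Lemma cycle_type_conj s t : cycle_type s = cycle_type t -> exists g : 'S_n, t = (s ^ g)%g.
Proof.
move=> /(congr1 val) /= e; apply: conj_of_cycle_sizes.
have pos r : filter (leq 1) (map val (cycle_tuple r)) = cycle_sizes r.
  rewrite cycle_tupleE filter_cat (all_filterP (cycle_sizes_gt0 r)).
  by rewrite -[RHS]cats0; congr (_ ++ _); elim: (_ - _).
by rewrite -pos e pos.
Qed.

End CycleType.

(** * The centre of the group algebra *)

Lemma card_porbitsJ (T : finType) (s t : {perm T}) :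
  #|porbits (s ^ t)%g| = #|porbits s|.
Proof.
have porbJ x : porbit (s ^ t)%g (t x) = t @: porbit s x.
  apply/setP=> y; apply/porbitP/imsetP => [[i ->]|[z /porbitP[i ->] ->]].
    by exists ((s ^+ i)%g x); rewrite ?mem_porbit // -conjXg permJ.
  by exists i; rewrite -conjXg permJ.
have -> : porbits (s ^ t)%g = [set t @: (C : {set T}) | C in porbits s].
  apply/setP=> C; apply/imsetP/imsetP => [[x _ ->]|[_ /imsetP[x _ ->] ->]].
    by exists (porbit s (t^-1%g x)); rewrite ?imset_f // -porbJ permKV.
  by exists (t x) => //; rewrite porbJ.
by apply: card_imset; apply: imset_inj; apply: perm_inj.
Qed.

Section Central.
Context (F : fieldType) (n : nat).
Local Notation A := (galg F 'S_n).
Implicit Types (x y : A) (s t g : 'S_n).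

Lemma mul_gbaser x g s : (x * gbase F g) (s * g)%g = x s.
Proof.
rewrite ffunE (bigD1 s) //= mulKg ffunE eqxx mulr1 big1 ?addr0 // => h hs.
rewrite ffunE; case: eqP => [e|_]; last by rewrite mulr0.
by case/eqP: hs; apply: (mulIg g); rewrite -{1}e mulKVg.
Qed.

Lemma mul_gbasel x g s : (gbase F g * x) (g * s)%g = x s.
Proof.
rewrite ffunE (bigD1 g) //= mulKg ffunE eqxx mul1r big1 ?addr0 // => h hg.
by rewrite ffunE (negPf hg) mul0r.
Qed.

Definition central x := forall y, x * y = y * x.

Lemma central_conj x s g : central x -> x (s ^ g)%g = x s.
Proof.
move=> xC; rewrite -[RHS](mul_gbaser x g) xC.
by rewrite -[in RHS](mulKVg g (s * g)%g) mul_gbasel conjgE.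
Qed.

Lemma gbase_expand x : x = \sum_s x s *: gbase F s.
Proof.
apply/ffunP=> s; rewrite sum_ffunE (bigD1 s) //= !ffunE eqxx mulr1.
by rewrite big1 ?addr0 // => t ts; rewrite !ffunE eq_sym (negPf ts) mulr0.
Qed.

Lemma central_gbase x : (forall g, x * gbase F g = gbase F g * x) -> central x.
Proof.
move=> xg y; rewrite (gbase_expand y) mulr_sumr mulr_suml.
by apply: eq_bigr => g _; rewrite -scalerAr xg scalerAl.
Qed.

Lemma central_cycsumT (w : F) : central (cycsum setT w).
Proof.
apply: central_gbase => g; rewrite /cycsum mulr_suml mulr_sumr.
rewrite [RHS](reindex_inj (conjg_inj g)) /=.
have onT s : perm_on [set: 'I_n] s by apply/subsetP=> i _; rewrite inE.
apply: eq_big => [s|s _]; first by rewrite !onT.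
rewrite -scalerAl -scalerAr -!gbaseM odd_permJ card_porbitsJ; congr (_ *: gbase F _).
by rewrite conjgE !mulgA mulgV mul1g.
Qed.

Lemma central_sum (I : finType) (a : I -> F) (f : I -> A) :
  (forall i, central (f i)) -> central (\sum_i a i *: f i).
Proof.
move=> fC y; rewrite mulr_suml mulr_sumr; apply: eq_bigr => i _.
by rewrite -scalerAl -scalerAr fC.
Qed.

Lemma centralB x y : central x -> central y -> central (x - y).
Proof. by move=> xC yC t; rewrite mulrBl mulrBr xC yC. Qed.

Definition type_rep (la : intpart n) : 'S_n :=
  odflt 1%g [pick s | cycle_type s == la].

Lemma type_repP s : cycle_type (type_rep (cycle_type s)) = cycle_type s.
Proof.
by rewrite /type_rep; case: pickP => [t /eqP //|/(_ s)]; rewrite eqxx.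
Qed.

Lemma central_eq0 x : central x -> (forall la, x (type_rep la) = 0) -> x = 0.
Proof.
move=> xC x0; apply/ffunP=> s; rewrite [RHS]ffunE.
have [g ->] := cycle_type_conj (type_repP s).
by rewrite central_conj.
Qed.

Hypothesis char0 : forall m, m.+1%:R != 0 :> F.
Context (chi : intpart n -> A).
Hypothesis chiC : forall la, central (chi la).
Hypothesis chi_young : forall la mu,
  chi la * young_symmetrizer F mu = (la == mu)%:R *: young_symmetrizer F mu.

Lemma sum_chi_young (a : intpart n -> F) mu :
  (\sum_la a la *: chi la) * young_symmetrizer F mu = a mu *: young_symmetrizer F mu.
Proof.
rewrite mulr_suml (bigD1 mu) //= big1 ?addr0 => [|la lamu].
  by rewrite -scalerAl chi_young eqxx scale1r.
by rewrite -scalerAl chi_young (negPf lamu) scale0r scaler0.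
Qed.

Let k := #|{: intpart n}|.
Let X : 'M[F]_k := \matrix_(i, j) chi (enum_val i) (type_rep (enum_val j)).

(** A central element is determined by its values at one permutation of each
    cycle type, so the coordinates of the [chi la] form a square matrix.  It is
    invertible since the actions on the symmetrizers separate the [chi la]. *)
Lemma central_span x : central x -> exists a, x = \sum_la a la *: chi la.
Proof.
move=> xC.
have combE (v : 'rV[F]_k) la : (\sum_mu v 0 (enum_rank mu) *: chi mu) (type_rep la)
    = (v *m X) 0 (enum_rank la).
  rewrite sum_ffunE mxE (reindex_onto enum_val enum_rank) => [|mu _]; last exact: enum_rankK.
  apply: eq_big => [i|i _]; first by rewrite enum_valK eqxx.
  by rewrite mxE ffunE enum_valK enum_rankK.
have Xfree : row_free X.
  apply: inj_row_free => v vX; apply/rowP=> i; rewrite [RHS]mxE.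
  have y0 : \sum_mu v 0 (enum_rank mu) *: chi mu = 0.
    apply: central_eq0 => [|la]; first exact: central_sum.
    by rewrite combE vX mxE.
  have := sum_chi_young (fun mu => v 0 (enum_rank mu)) (enum_val i).
  rewrite y0 mul0r enum_valK => /esym/eqP; rewrite scaler_eq0.
  by rewrite (negPf (young_symmetrizer_neq0 _ _)) orbF => /eqP.
have Xu : X \in unitmx by rewrite -row_free_unit.
pose v : 'rV[F]_k := (\row_j x (type_rep (enum_val j))) *m invmx X.
exists (fun mu => v 0 (enum_rank mu)); apply/eqP; rewrite -subr_eq0; apply/eqP.
apply: central_eq0 => [|la]; first by apply: centralB => //; apply: central_sum.
have : (x - \sum_mu v 0 (enum_rank mu) *: chi mu) (type_rep la)
  = x (type_rep la) - (\sum_mu v 0 (enum_rank mu) *: chi mu) (type_rep la).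
  by rewrite ffunE [X in _ + X]ffunE.
by rewrite combE /v mulmxKV // mxE enum_rankK subrr.
Qed.

Theorem Pi_cycsumT (w : F) : Pi chi w = cycsum setT w.
Proof.
have [a ea] := central_span (central_cycsumT w).
rewrite ea /Pi; apply: eq_bigr => mu _; congr (_ *: _).
have := cycsumT_young mu char0 w; rewrite ea sum_chi_young => /eqP.
rewrite -subr_eq0 -scalerBl scaler_eq0 (negPf (young_symmetrizer_neq0 _ _)) orbF.
by rewrite subr_eq0 => /eqP.
Qed.

End Central.

(** * Extension of scalars and conclusion *)

Section ScalarExtension.
Context (K L : comNzRingType) (f : {rmorphism K -> L}) (gT : finGroupType).
Implicit Types (x y : galg K gT).
Local Notation mapf := (@map_galg K L f gT).

Lemma map_galgM x y : mapf (x * y) = mapf x * mapf y.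
Proof.
apply/ffunP=> g; rewrite !ffunE rmorph_sum; apply: eq_bigr => h _.
by rewrite rmorphM !ffunE.
Qed.

Lemma map_galg_sum (I : Type) (r : seq I) (P : pred I) (x : I -> galg K gT) :
  mapf (\sum_(i <- r | P i) x i) = \sum_(i <- r | P i) mapf (x i).
Proof.
by apply/ffunP=> g; rewrite ffunE !sum_ffunE rmorph_sum; apply: eq_bigr => i _; rewrite ffunE.
Qed.

Lemma map_galgZ c x : mapf (c *: x) = f c *: mapf x.
Proof. by apply/ffunP=> g; rewrite !ffunE rmorphM. Qed.

Lemma map_gbase g : mapf (gbase K g) = gbase L g.
Proof. by apply/ffunP=> h; rewrite !ffunE rmorph_nat. Qed.
End ScalarExtension.

Lemma map_young (K L : comNzRingType) (f : {rmorphism K -> L}) n (la : intpart n) :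
  map_galg f (young_symmetrizer K la) = young_symmetrizer L la.
Proof.
rewrite /young_symmetrizer map_galgM !map_galg_sum; congr (_ * _).
  by apply: eq_bigr => s _; rewrite map_gbase.
by apply: eq_bigr => s _; rewrite map_galgZ map_gbase rmorph_sign.
Qed.

Lemma Phi_tilde_wcycsum (K L : fieldType) (f : {rmorphism K -> L}) (n : nat)
    (z : 'I_n -> L) (u v : L) (chi : intpart n -> galg K 'S_n) :
  (forall m, m.+1%:R != 0 :> L) -> (forall m, v + m.+1%:R != 0) ->
  (forall la : intpart n, is_central_idempotent la (chi la)) ->
  Phi_tilde (fun la => map_galg f (chi la)) z u v
  = wcycsum setT (wal u z) (wbe z) v.
Proof.
move=> char0 vn0 chiP; apply: Phi_tilde_subsets => [//||i /andP[i0 _]].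
  apply: Pi_cycsumT => // [la|la mu].
    have [chiC _ _ _] := chiP la.
    by apply: central_gbase => g; rewrite -(map_gbase f) -!map_galgM chiC.
  have [_ _ chi1 chi0] := chiP la.
  have irr (nu : intpart n) : in_irr nu (young_symmetrizer K nu).
    by exists 1; rewrite mul1r.
  rewrite -(map_young f) -map_galgM; case: eqVneq => [<-|lamu].
    by rewrite scale1r chi1.
  rewrite (chi0 mu) // 1?eq_sym // scale0r.
  by apply/ffunP=> s; rewrite !ffunE rmorph0.
by apply: Phi_subsets; rewrite -(prednK (fact_gt0 i)) char0.
Qed.

Theorem theorem4p7 (R : realType) (n : nat) (z : 'I_n -> R[i])
    (chi : intpart n -> galg R[i] 'S_n) :
  injective z ->
  (forall la : intpart n, is_central_idempotent la (chi la)) ->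
  let zK := fun a => rf_const (z a) in
  let chiK := fun la => map_galg (@rf_const R[i]) (chi la) in
  Phi_tilde chiK zK (rf_u R[i]) (rf_v R[i])
  = subst_galg (KZ zK) (P_tilde zK (rf_u R[i]) (rf_v R[i])).
Proof.
move=> zI chiP zK chiK.
pose f : {rmorphism R[i] -> ratfrac2 R[i]} :=
  @tofrac {poly {poly R[i]}} \o (polyC \o polyC).
have fI : injective f by apply: fmorph_inj.
rewrite subst_P_tilde => [|a b /fI/zI//].
apply: (@Phi_tilde_wcycsum _ _ f) => // m.
  by rewrite -(rmorph_nat f) fmorph_eq0 Num.Theory.pnatr_eq0.
rewrite -(rmorph_nat f) /rf_v -rmorphD tofrac_eq0 /=.
by rewrite -rmorphD polyC_eq0 -size_poly_eq0 size_XaddC.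
Qed.
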